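(* Let $p$ be a prime, $n_2$ a positive integer, $q=p^{n_2}$, and let $\varepsilon\in\mathbb{F}_{q^2}$ satisfy $\varepsilon^{q-1}=-1$. After extension of the ground field to $\mathbb{F}_{q^2}$, the Block algebra $A$ (defined in the context) is isomorphic with the Hamiltonian algebra $H(2:(1,n_2);\omega_2)$. An isomorphism is given by the linear map $\tau:A\to H(2:(1,n_2);\omega_2)$ defined by the formulas (both for $\alpha\in\mathbb{F}_p$) $$\begin{cases}\displaystyle\tau(f_{\alpha,\beta})=-\sum_{k=1}^{q-1}\beta^{-k+1}\varepsilon^k e_{k,\alpha}+\varepsilon\bar e_{1,\alpha}&\text{for }\beta\in\mathbb{F}_q^{\ast},\\ \tau(f_{\alpha,0})=\varepsilon\bar e_{1,\alpha},\end{cases}$$ in terms of the basis $\{e_{k,\alpha},\bar e_{1,\alpha}\}$ of $H(2:(1,n_2);\omega_2)$, or, in terms of divided powers, by $$\begin{cases}\displaystyle\tau(f_{\alpha,\beta}-f_{\alpha,0})=\sum_{j=1}^{q-1}j\varepsilon^{1-j}\beta^j\,\bar x y^{(j)}+\sum_{i=0}^{p-1}\sum_{j=1}^{q-1}\varepsilon^{1-j}\alpha^i\beta^j\,x^{(i)}y^{(j)}&\text{for }\beta\in\mathbb{F}_q^{\ast},\\ \displaystyle\tau(f_{\alpha,0})=\varepsilon\sum_{i=1}^{p-1}\alpha^i\,(x^{(i)}-i\,x^{(i)}\bar y).\end{cases}$$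
   Context: The convention $0^0=1$ is in force. The Block algebra $A$ has basis $\{f_{u,\alpha}\mid(u,\alpha)\in(\mathbb{F}_p\times\mathbb{F}_q)\setminus\{(0,0)\}\}$ and Lie bracket $[f_{u,\alpha},f_{v,\beta}]=(v\alpha-u\beta)\cdot f_{u+v,\alpha+\beta}$, where $0\cdot f_{0,0}$ is read as zero. It is defined over $\mathbb{F}_q$, and here is considered over the extension $\mathbb{F}_{q^2}$. In the formulas for $\tau$, $f_{0,0}$ is read as zero (and $\bar e_{1,0}=0$). Divided powers: over a field $\mathbb{F}$ of characteristic $p$ (here $\mathbb{F}=\mathbb{F}_{q^2}$), for $\mathbf{n}=(n_1,n_2)$ the algebra $\mathbb{F}[2:\mathbf{n}]$ is the commutative associative $\mathbb{F}$-algebra with basis the monomials $x^{(i)}y^{(j)}$, $0\le i<p^{n_1}$, $0\le j<p^{n_2}$, and multiplication $x^{(i)}y^{(j)}\cdot x^{(k)}y^{(l)}=\binom{i+k}{i}\binom{j+l}{j}x^{(i+k)}y^{(j+l)}$ (monomials with an exponent outside the allowed range are zero); $x^{(0)}y^{(0)}=1$. The derivations $\partial/\partial x$, $\partial/\partial y$ send $x^{(i)}y^{(j)}$ to $x^{(i-1)}y^{(j)}$ and $x^{(i)}y^{(j-1)}$ respectively (zero if an exponent becomes negative); write $f_x,f_y$ for the partial derivatives of $f$. Put $\bar x=x^{(p^{n_1}-1)}$, $\bar y=y^{(p^{n_2}-1)}$, $e=\bar x\bar y$. The Hamiltonian algebra $H(2:\mathbf{n};\omega_2)$ is the second derived algebra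 of the Lie algebra of those derivations $D=f\,\partial/\partial x+g\,\partial/\partial y$ ($f,g\in\mathbb{F}[2:\mathbf{n}]$) which annihilate $\omega_2=(1-e)\,dx\wedge dy$; it is identified with $\mathbb{F}[2:\mathbf{n}]/\langle 1\rangle$ with Lie bracket induced by the Poisson bracket $\{f,g\}=(1+e)(f_yg_x-f_xg_y)$, classes of monomials being denoted by the monomials themselves. Basis of $H(2:(1,n_2);\omega_2)$ (here $n_1=1$): for $\alpha\in\mathbb{F}_p$ and $j=1,\dots,q-1$, $$e_{1-j,\alpha}=j\,\bar x y^{(j)}+\sum_{i=0}^{p-1}\alpha^i x^{(i)}y^{(j)},$$ with first subscript read modulo $q-1$ (so $e_{k,\alpha}$ is defined for every integer $k$ modulo $q-1$; for example $e_{1,\alpha}=e_{2-q,\alpha}$, corresponding to $j=q-1$), and for $\alpha\in\mathbb{F}_p^{\ast}$, $$\bar e_{1,\alpha}=\sum_{i=1}^{p-1}\alpha^i\,(x^{(i)}-i\,x^{(i)}\bar y),$$ with $\bar e_{1,0}=0$. *)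

(* Defs.v *)
From HB Require Import structures.
From mathcomp Require Import all_boot all_order all_algebra all_field ring.
Set Implicit Arguments.
Unset Strict Implicit.
Unset Printing Implicit Defensive.
Import GRing.Theory.
Local Open Scope ring_scope.

Definition divpow (F : fieldType) (p n1 n2 : nat) : Type :=
  'M[F]_(p ^ n1, p ^ n2).

HB.instance Definition _ (F : fieldType) (p n1 n2 : nat) :=
  Vector.copy (divpow F p n1 n2) 'M[F]_(p ^ n1, p ^ n2).

Definition dpcoef (F : fieldType) (p n1 n2 : nat) (f : divpow F p n1 n2) :
  'I_(p ^ n1) -> 'I_(p ^ n2) -> F := fun i j => (f : 'M[F]_(_, _)) i j.

(* x^(i) y^(j); this is 0 when i or j is out of range. *)
Definition mon (F : fieldType) (p n1 n2 i j : nat) : divpow F p n1 n2 :=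
  \matrix_(r, s) ((r == i :> nat) && (s == j :> nat))%:R.
Arguments mon {F p n1 n2} i j.

Section DividedPowers.
Variables (F : fieldType) (p n1 n2 : nat).
Notation DP := (divpow F p n1 n2).
Notation mon := (@mon F p n1 n2).
Implicit Types f g h : DP.

Definition dpone : DP := mon 0 0.

Definition dpmul f g : DP :=
  \sum_(i < p ^ n1) \sum_(j < p ^ n2) \sum_(k < p ^ n1) \sum_(l < p ^ n2)
    (dpcoef f i j * dpcoef g k l * ('C(i + k, i) * 'C(j + l, j))%:R)
      *: mon (i + k) (j + l).

Definition ddx f : DP :=
  \sum_(i < p ^ n1) \sum_(j < p ^ n2 | (0 < i)%N) dpcoef f i j *: mon i.-1 j.

Definition ddy f : DP :=
  \sum_(i < p ^ n1) \sum_(j < p ^ n2 | (0 < j)%N) dpcoef f i j *: mon i j.-1.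

Lemma dpcoefP a f g i j : dpcoef (a *: f + g) i j = a * dpcoef f i j + dpcoef g i j.
Proof. by rewrite /dpcoef [LHS]mxE mxE. Qed.

Lemma monE i j (r : 'I_(p ^ n1)) (s : 'I_(p ^ n2)) :
  dpcoef (mon i j) r s = ((r == i :> nat) && (s == j :> nat))%:R.
Proof. by rewrite /dpcoef mxE. Qed.

Lemma mon_oversize i j : (p ^ n1 <= i)%N || (p ^ n2 <= j)%N -> mon i j = 0.
Proof.
move=> H; apply/matrixP => r s; rewrite mxE [RHS]mxE.
case: eqP => [ri|] //=; case: eqP => [sj|] //=.
by move: H; rewrite -ri -sj (leqNgt _ r) (leqNgt _ s) !ltn_ord.
Qed.

Lemma dp_expand f : f = \sum_(i < p ^ n1) \sum_(j < p ^ n2) dpcoef f i j *: mon i j.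
Proof.
rewrite [LHS](matrix_sum_delta (f : 'M_(_, _))).
apply: eq_bigr => i _; apply: eq_bigr => j _; congr (_ *: _).
by apply/matrixP => r s; rewrite !mxE.
Qed.

Lemma dp_linear_ext (V : lmodType F) (u v : DP -> V) :
    linear u -> linear v ->
    (forall (i : 'I_(p ^ n1)) (j : 'I_(p ^ n2)), u (mon i j) = v (mon i j)) ->
  u =1 v.
Proof.
move=> ulin vlin Huv f.
pose U := GRing.isLinear.Build F DP V *:%R u ulin.
pose V' := GRing.isLinear.Build F DP V *:%R v vlin.
pose uL : {linear DP -> V} := HB.pack u U.
pose vL : {linear DP -> V} := HB.pack v V'.
rewrite -[u]/(uL : _ -> _) -[v]/(vL : _ -> _) [f]dp_expand !linear_sum.
apply: eq_bigr => i _; rewrite !linear_sum; apply: eq_bigr => j _.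
by rewrite !linearZ /= Huv.
Qed.

Fact dpmul_linearr f : linear (dpmul f).
Proof.
move=> a g h; rewrite /dpmul scaler_sumr -big_split; apply: eq_bigr => i _ /=.
rewrite scaler_sumr -big_split; apply: eq_bigr => j _ /=.
rewrite scaler_sumr -big_split; apply: eq_bigr => k _ /=.
rewrite scaler_sumr -big_split; apply: eq_bigr => l _ /=.
by rewrite dpcoefP scalerA -scalerDl mulrDr mulrDl !mulrA [_ * a]mulrC.
Qed.

Fact dpmulC : commutative dpmul.
Proof.
move=> f g; rewrite /dpmul.
under eq_bigr do rewrite exchange_big.
rewrite exchange_big /=; apply: eq_bigr => k _.
under eq_bigr do rewrite exchange_big.
rewrite exchange_big /=; apply: eq_bigr => l _.
apply: eq_bigr => i _; apply: eq_bigr => j _.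
rewrite (addnC k) (addnC l) [dpcoef f i j * _]mulrC; congr ((_ * _%:R) *: _).
by rewrite -bin_sub ?leq_addr // addKn -['C(j + l, j)]bin_sub ?leq_addr // addKn.
Qed.

Fact dpmul_linearl g : linear (dpmul^~ g).
Proof. by move=> a f h; rewrite dpmulC dpmul_linearr !(dpmulC g). Qed.

HB.instance Definition _ f :=
  GRing.isLinear.Build F DP DP *:%R (dpmul f) (dpmul_linearr f).

Fact dpmul_mon i j k l :
  dpmul (mon i j) (mon k l) = ('C(i + k, i) * 'C(j + l, j))%:R *: mon (i + k) (j + l).
Proof.
case: (ltnP i (p ^ n1)) => [ii|oi]; last first.
  rewrite mon_oversize ?oi // dpmulC linear0.
  by rewrite mon_oversize ?scaler0 // (leq_trans oi) ?leq_addr.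
case: (ltnP j (p ^ n2)) => [jj|oj]; last first.
  rewrite mon_oversize ?oj ?orbT // dpmulC linear0.
  by rewrite mon_oversize ?scaler0 // (leq_trans oj) ?leq_addr ?orbT.
case: (ltnP k (p ^ n1)) => [kk|ok]; last first.
  rewrite (@mon_oversize k) ?ok // linear0.
  by rewrite mon_oversize ?scaler0 // (leq_trans ok) ?leq_addl.
case: (ltnP l (p ^ n2)) => [ll|ol]; last first.
  rewrite (@mon_oversize k) ?ol ?orbT // linear0.
  by rewrite mon_oversize ?scaler0 // (leq_trans ol) ?leq_addl ?orbT.
rewrite /dpmul (bigD1 (Ordinal ii)) //= (bigD1 (Ordinal jj)) //=.
rewrite (bigD1 (Ordinal kk)) //= (bigD1 (Ordinal ll)) //=.
rewrite [X in _ + X]big1 ?addr0; last first.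
  move=> i'; rewrite -val_eqE /= => ni; rewrite big1 // => j' _; rewrite big1 // => k' _.
  by rewrite big1 // => l' _; rewrite !monE (negPf ni) !mul0r scale0r.
rewrite [X in _ + X]big1 ?addr0; last first.
  move=> j'; rewrite -val_eqE /= => nj; rewrite big1 // => k' _; rewrite big1 // => l' _.
  by rewrite !monE (negPf nj) andbF !mul0r scale0r.
rewrite [X in _ + X]big1 ?addr0; last first.
  move=> k'; rewrite -val_eqE /= => nk; rewrite big1 // => l' _.
  by rewrite !monE (negPf nk) mulr0 mul0r scale0r.
rewrite [X in _ + X]big1 ?addr0 ?monE ?eqxx ?mul1r // => l'; rewrite -val_eqE /= => nl.
by rewrite !monE (negPf nl) andbF mulr0 mul0r scale0r.
Qed.

Fact bin_assoc i k m :
  ('C(i + k, i) * 'C(i + k + m, i + k) = 'C(k + m, k) * 'C(i + (k + m), i))%N.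
Proof.
have H := @bin_fact; rewrite -addnA.
have h1 := H (i + k)%N i (leq_addr _ _).
have h2 := H (i + (k + m))%N (i + k)%N.
have h3 := H (k + m)%N k (leq_addr _ _).
have h4 := H (i + (k + m))%N i (leq_addr _ _).
move: h1 h3 h4; rewrite !addKn => h1 h3 h4.
have {}h2 : ('C(i + (k + m), i + k) * ((i + k)`! * m`!) = (i + (k + m))`!)%N.
  by rewrite -h2 addnA ?leq_addr // addKn.
apply/eqP; rewrite -(@eqn_pmul2r (i`! * k`! * m`!)) ?muln_gt0 ?fact_gt0 //; apply/eqP.
transitivity ((i + (k + m))`!); first by rewrite -h2 -h1; ring.
by rewrite -h4 -h3; ring.
Qed.

Fact dpmulA : associative dpmul.
Proof.
move=> f g h; move: f.
apply: dp_linear_ext.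
- by move=> a f f'; rewrite dpmul_linearl.
- by move=> a f f'; rewrite !dpmul_linearl.
move=> i j; move: g.
apply: dp_linear_ext.
- by move=> a f f'; rewrite dpmul_linearl linearP.
- by move=> a f f'; rewrite linearP dpmul_linearl.
move=> k l; move: h.
apply: dp_linear_ext.
- by move=> a f f'; rewrite !linearP.
- by move=> a f f'; rewrite linearP.
move=> r s; rewrite !dpmul_mon linearZ /= dpmul_mon.
rewrite [RHS]dpmulC [RHS]linearZ /= (dpmulC (mon r s)) dpmul_mon.
rewrite !scalerA -!natrM mulnACA -!bin_assoc mulnACA.
by rewrite !addnA.
Qed.

Fact dpmul1 : left_id dpone dpmul.
Proof.
apply: dp_linear_ext => //; first exact: dpmul_linearr.
by move=> i j; rewrite dpmul_mon !bin0 scale1r.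
Qed.

Fact dpmulDl : left_distributive dpmul +%R.
Proof. by move=> f g h; have := dpmul_linearl h 1 f g; rewrite !scale1r. Qed.

(* The Pz variant of rings is used because no assumption on p is made here. *)
HB.instance Definition _ :=
  GRing.Zmodule_isComPzRing.Build DP dpmulA dpmulC dpmul1 dpmulDl.

Fact ddx_linear : linear ddx.
Proof.
move=> a f g; rewrite /ddx scaler_sumr -big_split; apply: eq_bigr => i _ /=.
rewrite scaler_sumr -big_split; apply: eq_bigr => j _ /=.
by rewrite dpcoefP scalerA scalerDl.
Qed.

Fact ddy_linear : linear ddy.
Proof.
move=> a f g; rewrite /ddy scaler_sumr -big_split; apply: eq_bigr => i _ /=.
rewrite scaler_sumr -big_split; apply: eq_bigr => j _ /=.
by rewrite dpcoefP scalerA scalerDl.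
Qed.

HB.instance Definition _ := GRing.isLinear.Build F DP DP *:%R ddx ddx_linear.
HB.instance Definition _ := GRing.isLinear.Build F DP DP *:%R ddy ddy_linear.

Lemma dp_scaleAr a f g : f * (a *: g) = a *: (f * g).
Proof. by change (dpmul f (a *: g) = a *: dpmul f g); rewrite linearZ. Qed.

Lemma dp_scaleAl a f g : (a *: f) * g = a *: (f * g).
Proof. by rewrite mulrC dp_scaleAr mulrC. Qed.

End DividedPowers.

Section Leibniz.
Variables (F : fieldType) (p n1 n2 : nat).
Hypothesis charFp : p \in [pchar F].
Notation DP := (divpow F p n1 n2).
Notation mon := (@mon F p n1 n2).
Implicit Types f g h : DP.

Let p_pr : prime p := pcharf_prime charFp.

Lemma ddx_mon i j : (i < p ^ n1)%N ->
  ddx (mon i j) = if (0 < i)%N then mon i.-1 j else 0.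
Proof.
move=> ii; case: (ltnP j (p ^ n2)) => [jj|oj]; last first.
  by rewrite !mon_oversize ?oj ?orbT // linear0 if_same.
rewrite /ddx (bigD1 (Ordinal ii)) //= [X in _ + X]big1 ?addr0; last first.
  move=> i'; rewrite -val_eqE /= => ni; rewrite big1 // => j' _.
  by rewrite monE (negPf ni) scale0r.
case: ifP => [i_gt0|_]; last by rewrite big_pred0.
rewrite (bigD1 (Ordinal jj)) //= big1 ?addr0 ?monE ?eqxx ?scale1r // => j'.
by rewrite -val_eqE /= => nj; rewrite monE (negPf nj) andbF scale0r.
Qed.

Lemma ddy_mon i j : (j < p ^ n2)%N ->
  ddy (mon i j) = if (0 < j)%N then mon i j.-1 else 0.
Proof.
move=> jj; case: (ltnP i (p ^ n1)) => [ii|oi]; last first.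
  by rewrite !mon_oversize ?oi // linear0 if_same.
rewrite /ddy (bigD1 (Ordinal ii)) //= [X in _ + X]big1 ?addr0; last first.
  move=> i'; rewrite -val_eqE /= => ni; rewrite big1 // => j' _.
  by rewrite monE (negPf ni) scale0r.
case: ifP => [j_gt0|j0]; last first.
  rewrite big1 // => j' j'_gt0; rewrite monE.
  case: (_ =P j :> nat) => [j'j|_]; last by rewrite andbF scale0r.
  by rewrite -j'j j'_gt0 in j0.
rewrite (bigD1 (Ordinal jj)) //= big1 ?addr0 ?monE ?eqxx ?scale1r // => j'.
by rewrite -val_eqE /= => /andP[_ nj]; rewrite monE (negPf nj) andbF scale0r.
Qed.

Lemma ddx_coef f (r r' : 'I_(p ^ n1)) s :
  r.+1 = r' -> dpcoef (ddx f) r s = dpcoef f r' s.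
Proof.
move=> rr'; move: f; apply: (@dp_linear_ext F p n1 n2 F^o) => [a f g|a f g|i j].
- by rewrite linearP dpcoefP.
- by rewrite dpcoefP.
rewrite ddx_mon // monE -rr'; case: i => -[|i] ltin /=; last by rewrite monE.
by rewrite [LHS]mxE.
Qed.

Lemma ddy_coef f r (s s' : 'I_(p ^ n2)) :
  s.+1 = s' -> dpcoef (ddy f) r s = dpcoef f r s'.
Proof.
move=> ss'; move: f; apply: (@dp_linear_ext F p n1 n2 F^o) => [a f g|a f g|i j].
- by rewrite linearP dpcoefP.
- by rewrite dpcoefP.
rewrite ddy_mon // monE -ss'; case: j => -[|j] ltjn /=; last by rewrite monE.
by rewrite andbF [LHS]mxE.
Qed.

Lemma ddxy f : ddx (ddy f) = ddy (ddx f).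
Proof.
move: f; apply: dp_linear_ext => [a f g|a f g|i j]; rewrite ?linearP //.
rewrite ddx_mon // ddy_mon //; case: (posnP i) => [i0|i_gt0]; last first.
  have i1 : (i.-1 < p ^ n1)%N by rewrite (leq_ltn_trans (leq_pred _)).
  rewrite ddy_mon //; case: ifP; rewrite ?linear0 // => j_gt0.
  by rewrite ddx_mon // i_gt0.
rewrite linear0; case: ifP; rewrite ?linear0 // => j_gt0.
by rewrite ddx_mon // i0.
Qed.

(* (x^(i) x^(k))' = x^(i-1) x^(k) + x^(i) x^(k-1), at the level of coefficients;
   the case i + k = p ^ n is where the characteristic matters. *)
Lemma leibniz_bin n i k : (0 < i < p ^ n)%N -> (0 < k < p ^ n)%N ->
    ((i + k).-1 < p ^ n)%N ->
  ('C((i + k).-1, i.-1) + 'C((i + k).-1, i))%:R =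
    (if (i + k < p ^ n)%N then 'C(i + k, i)%:R else 0) :> F.
Proof.
case: i => // i /= ii; case: k => // k /= kk ltik.
rewrite addSn /= addnC -binS; case: ltnP => // geik.
have {ltik geik}eqik : (i + k.+1).+1 = (p ^ n)%N.
  by apply/eqP; rewrite eqn_leq geik andbT.
apply/eqP; rewrite -(dvdn_pcharf charFp) eqik; apply: contraT => ndvd.
have cop : coprime (p ^ n) 'C(p ^ n, i.+1) by rewrite coprimeXl // prime_coprime.
have : (p ^ n %| i.+1)%N.
  by rewrite -(Gauss_dvdl _ cop) -mul_bin_diag dvdn_mulr.
by move/dvdn_leq => /(_ isT); rewrite leqNgt ii.
Qed.

Lemma ddxM f g : ddx (f * g) = ddx f * g + f * ddx g.
Proof.
change (ddx (dpmul f g) = dpmul (ddx f) g + dpmul f (ddx g)); move: g.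
apply: dp_linear_ext => [c h k|c h k|k l].
- by rewrite !linearP.
- by rewrite !linearP /= scalerDr addrACA.
move: f; apply: dp_linear_ext => [c h h'|c h h'|i j].
- by rewrite dpmul_linearl linearP.
- by rewrite linearP !dpmul_linearl scalerDr addrACA.
rewrite dpmul_mon linearZ /= !(ddx_mon _ (ltn_ord _)).
have jl0 : dpmul 0 (mon k l) = 0 by rewrite dpmulC linear0.
case: (posnP i) => [i0|i_gt0].
  rewrite i0 !add0n bin0 mul1n jl0 add0r ddx_mon //.
  by case: ifP => _; rewrite ?linear0 ?scaler0 // dpmul_mon bin0 mul1n.
case: (posnP k) => [k0|k_gt0].
  rewrite k0 addn0 binn mul1n linear0 addr0 ddx_mon // i_gt0.
  by rewrite dpmul_mon addn0 binn mul1n.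
have [Ei Ek] : (i.-1 + k = (i + k).-1)%N /\ (i + k.-1 = (i + k).-1)%N.
  by case: (val i) i_gt0 => // a _; case: (val k) k_gt0 => // b _; rewrite !(addSn, addnS).
rewrite !dpmul_mon Ei Ek -scalerDl -natrD -mulnDl.
case: (ltnP (i + k).-1 (p ^ n1)) => [lt_ik|ge_ik]; last first.
  by rewrite !mon_oversize ?ge_ik ?(leq_trans ge_ik) ?leq_pred // linear0 !scaler0.
have := @leibniz_bin n1 i k; rewrite i_gt0 k_gt0 !ltn_ord => /(_ isT isT lt_ik) E.
rewrite [in RHS]natrM E [in LHS]natrM; case: ltnP => [lt|ge].
  by rewrite ddx_mon // addn_gt0 i_gt0.
by rewrite mon_oversize ?ge // linear0 mul0r scale0r scaler0.
Qed.

Lemma ddyM f g : ddy (f * g) = ddy f * g + f * ddy g.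
Proof.
change (ddy (dpmul f g) = dpmul (ddy f) g + dpmul f (ddy g)); move: g.
apply: dp_linear_ext => [c h k|c h k|k l].
- by rewrite !linearP.
- by rewrite !linearP /= scalerDr addrACA.
move: f; apply: dp_linear_ext => [c h h'|c h h'|i j].
- by rewrite dpmul_linearl linearP.
- by rewrite linearP !dpmul_linearl scalerDr addrACA.
rewrite dpmul_mon linearZ /= !(ddy_mon _ (ltn_ord _)).
have ik0 : dpmul 0 (mon k l) = 0 by rewrite dpmulC linear0.
case: (posnP j) => [j0|j_gt0].
  rewrite j0 !add0n bin0 muln1 ik0 add0r ddy_mon //.
  by case: ifP => _; rewrite ?linear0 ?scaler0 // dpmul_mon bin0 muln1.
case: (posnP l) => [l0|l_gt0].
  rewrite l0 addn0 binn muln1 linear0 addr0 ddy_mon // j_gt0.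
  by rewrite dpmul_mon addn0 binn muln1.
have [Ej El] : (j.-1 + l = (j + l).-1)%N /\ (j + l.-1 = (j + l).-1)%N.
  by case: (val j) j_gt0 => // a _; case: (val l) l_gt0 => // b _; rewrite !(addSn, addnS).
rewrite !dpmul_mon Ej El -scalerDl -natrD -mulnDr.
case: (ltnP (j + l).-1 (p ^ n2)) => [lt_jl|ge_jl]; last first.
  by rewrite !mon_oversize ?ge_jl ?(leq_trans ge_jl) ?leq_pred ?orbT // linear0 !scaler0.
have := @leibniz_bin n2 j l; rewrite j_gt0 l_gt0 !ltn_ord => /(_ isT isT lt_jl) E.
rewrite [in RHS]natrM E [in LHS]natrM; case: ltnP => [lt|ge].
  by rewrite ddy_mon // addn_gt0 j_gt0.
by rewrite mon_oversize ?ge ?orbT // linear0 mulr0 scale0r scaler0.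
Qed.

End Leibniz.

(* Meant for a bilinear br, for which the brackets of a basis of U span the
   same space as all the brackets of elements of U. *)
Definition derived (F : fieldType) (V : vectType F) (br : V -> V -> V)
    (U : {vspace V}) : {vspace V} :=
  <<[seq br u v | u <- vbasis U, v <- vbasis U]>>%VS.

Lemma derived_subvP (F : fieldType) (V : vectType F) (br : V -> V -> V)
    (U W : {vspace V}) :
    (forall u, linear (br u)) -> (forall v, linear (br^~ v)) ->
  reflect (forall u v, u \in U -> v \in U -> br u v \in W)
          (derived br U <= W)%VS.
Proof.
move=> linr linl; apply: (iffP span_subvP) => [sW u v uU vU | sW w]; last first.
  by case/allpairsP => -[u v] /= [uU vU ->]; apply: sW; apply: vbasis_mem.
pose brl w : {linear V -> V} := HB.pack (br^~ w) (GRing.isLinear.Build F V V *:%R _ (linl w)).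
pose brr w : {linear V -> V} := HB.pack (br w) (GRing.isLinear.Build F V V *:%R _ (linr w)).
rewrite (coord_vbasis uU) -[br _ v]/(brl v _) linear_sum memv_suml // => i _.
rewrite linearZ memvZ //= (coord_vbasis vU) -[br _ _]/(brr _ _) linear_sum.
rewrite memv_suml // => j _; rewrite linearZ memvZ //= sW //.
by apply: allpairs_f; rewrite mem_nth // size_tuple.
Qed.

Definition lie_isomorphism_onto (F : fieldType) (A V : vectType F)
    (brA : A -> A -> A) (brV : V -> V -> V) (tau : 'Hom(A, V)) (H : {vspace V}) :=
  [/\ lker tau == 0%VS, limg tau = H
    & forall a b, tau (brA a b) = brV (tau a) (tau b)].

(* The pair (f, g) stands for the derivation f d/dx + g d/dy. *)
Definition vfield (F : fieldType) (p n1 n2 : nat) : Type :=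
  (divpow F p n1 n2 * divpow F p n1 n2)%type.

HB.instance Definition _ (F : fieldType) (p n1 n2 : nat) :=
  Vector.copy (vfield F p n1 n2) (divpow F p n1 n2 * divpow F p n1 n2)%type.

Section VectorFields.
Variables (F : fieldType) (p n1 n2 : nat).
Notation DP := (divpow F p n1 n2).
Notation VF := (vfield F p n1 n2).
Implicit Types (f g u : DP) (D E : VF).

Definition vf_act D f : DP := D.1 * ddx f + D.2 * ddy f.

Definition vf_br D E : VF :=
  (vf_act D E.1 - vf_act E D.1, vf_act D E.2 - vf_act E D.2).

(* D (u dx /\ dy) = (D u + u (f_x + g_y)) dx /\ dy for D = f d/dx + g d/dy,
   because D (dx) = df and D (dy) = dg. *)
Definition vf_lie2 u D : DP := vf_act D u + u * (ddx D.1 + ddy D.2).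

Fact vf_lie2_linear u : linear (vf_lie2 u).
Proof.
move=> a D E; rewrite /vf_lie2 /vf_act /= !linearP /=.
rewrite !mulrDl !mulrDr !dp_scaleAl !dp_scaleAr !scalerDr.
ring.
Qed.

HB.instance Definition _ u :=
  GRing.isLinear.Build F VF DP *:%R (vf_lie2 u) (vf_lie2_linear u).

(* The derivations annihilating u dx /\ dy. *)
Definition annihilator2 u : {vspace VF} := lker (linfun (vf_lie2 u)).

Lemma mem_annihilator2 u D : (D \in annihilator2 u) = (vf_lie2 u D == 0).
Proof. by rewrite memv_ker lfunE. Qed.

Definition dpe : DP := mon (p ^ n1).-1 (p ^ n2).-1.

(* H(2:n; omega_2), where omega_2 = (1 - e) dx /\ dy. *)
Definition hamilton2 : {vspace VF} :=
  derived vf_br (derived vf_br (annihilator2 (1 - dpe))).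

(* The element of H(2:n; omega_2) denoted by the class of f in F[2:n]/<1>:
   it is the derivation g |-> {f, g}. *)
Definition ham f : VF := ((1 + dpe) * ddy f, - ((1 + dpe) * ddx f)).

Definition poisson f g : DP := (1 + dpe) * (ddy f * ddx g - ddx f * ddy g).

Fact ham_linear : linear ham.
Proof.
by move=> a f g; rewrite /ham !linearP !mulrDr !dp_scaleAr opprD -scalerN.
Qed.

HB.instance Definition _ := GRing.isLinear.Build F DP VF *:%R ham ham_linear.

Lemma ham_act f g : vf_act (ham f) g = poisson f g.
Proof. by rewrite /vf_act /poisson /=; ring. Qed.

Fact vf_br_linearr D : linear (vf_br D).
Proof.
move=> a E E'; rewrite /vf_br /vf_act /=.
congr (_, _); rewrite /= !linearP /= !mulrDl !mulrDr !dp_scaleAl !dp_scaleAr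
  !scalerBr !scalerDr; ring.
Qed.

Fact vf_br_linearl E : linear (vf_br^~ E).
Proof.
move=> a D D'; rewrite /vf_br /vf_act /=.
congr (_, _); rewrite /= !linearP /= !mulrDl !mulrDr !dp_scaleAl !dp_scaleAr
  !scalerBr !scalerDr; ring.
Qed.

Hypothesis charFp : p \in [pchar F].

Lemma vf_brE D E f :
  vf_act (vf_br D E) f = vf_act D (vf_act E f) - vf_act E (vf_act D f).
Proof.
rewrite /vf_br /vf_act /= !linearD /= !(ddxM charFp, ddyM charFp) !ddxy.
ring.
Qed.

Lemma ham_poisson f g : vf_br (ham f) (ham g) = ham (poisson f g).
Proof.
rewrite /vf_br /vf_act /poisson /ham /=; congr (_, _).
  rewrite !(linearN, linearD, ddxM charFp, ddyM charFp) /=.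
  rewrite !(linearN, linearD, ddxM charFp, ddyM charFp) /= !ddxy.
  ring.
rewrite !(linearN, linearD, ddxM charFp, ddyM charFp) /=.
rewrite !(linearN, linearD, ddxM charFp, ddyM charFp) /= !ddxy.
ring.
Qed.

Hypothesis n1_gt0 : (0 < n1)%N.

Lemma dpe_sqr : (1 - dpe) * (1 + dpe) = 1.
Proof.
have p_gt1 := prime_gt1 (pcharf_prime charFp).
have : (1 < p ^ n1)%N by rewrite -(exp1n n1) ltn_exp2r.
have : dpe * dpe = 0.
  have {}H : (1 < p ^ n1)%N by rewrite -(exp1n n1) ltn_exp2r.
  change (dpmul dpe dpe = 0); rewrite dpmul_mon mon_oversize ?scaler0 //.
  by case: (p ^ n1)%N H => [|[|m]] // _; rewrite /= addnS ltnS leq_addr.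
move=> ee _; have -> : (1 - dpe) * (1 + dpe) = 1 - dpe * dpe by ring.
by rewrite ee subr0.
Qed.

Lemma ham_annihilator2 f : ham f \in annihilator2 (1 - dpe).
Proof.
rewrite mem_annihilator2; apply/eqP.
have <- : ddx ((1 - dpe) * (ham f).1) + ddy ((1 - dpe) * (ham f).2)
        = vf_lie2 (1 - dpe) (ham f).
  by rewrite /vf_lie2 /vf_act !(ddxM charFp, ddyM charFp); ring.
by rewrite /= mulrN !mulrA dpe_sqr !mul1r linearN ddxy addrN.
Qed.

Lemma ham_eq0 f : (ham f == 0) = (f \in <[1 : DP]>%VS).
Proof.
have p_gt1 := prime_gt1 (pcharf_prime charFp).
have p1 : (0 < p ^ n1)%N by rewrite expn_gt0 ltnW.
have p2 : (0 < p ^ n2)%N by rewrite expn_gt0 ltnW.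
apply/eqP/vlineP => [Hf | [c ->]]; last first.
  rewrite linearZ /= /ham (_ : 1 = mon 0 0 :> DP) // ddx_mon // ddy_mon //=.
  by rewrite !mulr0 oppr0; apply: scaler0.
have [Hfy Hfx] : (1 + dpe) * ddy f = 0 /\ (1 + dpe) * ddx f = 0.
  by split; [exact: (congr1 fst Hf) | apply: oppr_inj; rewrite oppr0; exact: (congr1 snd Hf)].
have fy : ddy f = 0.
  by rewrite -[ddy f]mul1r -dpe_sqr -mulrA Hfy mulr0.
have fx : ddx f = 0.
  by rewrite -[ddx f]mul1r -dpe_sqr -mulrA Hfx mulr0.
exists (dpcoef f (Ordinal p1) (Ordinal p2)); apply/matrixP => r s.
have -> : (dpcoef f (Ordinal p1) (Ordinal p2) *: (1 : DP) : 'M_(_, _)) r s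
          = dpcoef f (Ordinal p1) (Ordinal p2) * dpcoef (mon 0 0) r s.
  by rewrite [LHS]mxE.
rewrite -/(dpcoef f r s) monE.
case: (posnP r) => [r0|r_gt0]; last first.
  have r1 : (r.-1 < p ^ n1)%N by rewrite (leq_ltn_trans (leq_pred _)).
  rewrite mulr0 -(@ddx_coef F p n1 n2 f (Ordinal r1) r s) /= ?prednK //.
  by rewrite fx [LHS]mxE.
case: (posnP s) => [s0|s_gt0]; last first.
  have s1 : (s.-1 < p ^ n2)%N by rewrite (leq_ltn_trans (leq_pred _)).
  rewrite mulr0 -(@ddy_coef F p n1 n2 f r (Ordinal s1) s) /= ?prednK //.
  by rewrite fy [LHS]mxE.
by rewrite mulr1; congr dpcoef; apply: val_inj.
Qed.

End VectorFields.

Definition Fp_in (R : pzRingType) (p : nat) (u : 'F_p) : R := (u : nat)%:R.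

Definition block_index (p : nat) (K : finFieldType) : Type :=
  {s : 'F_p * K | s != 0}.

HB.instance Definition _ (p : nat) (K : finFieldType) :=
  Finite.copy (block_index p K) {s : 'F_p * K | s != 0}.

(* Scalar extension to F of the Block algebra over K = F_q. *)
Definition block (F : fieldType) (p : nat) (K : finFieldType) : Type :=
  {ffun block_index p K -> F^o}.

HB.instance Definition _ (F : fieldType) (p : nat) (K : finFieldType) :=
  Vector.copy (block F p K) {ffun block_index p K -> F^o}.

(* f_{u,a}; this is 0 when (u, a) = (0, 0). *)
Definition block_gen (F : fieldType) (p : nat) (K : finFieldType)
    (u : 'F_p) (a : K) : block F p K :=
  [ffun s : block_index p K => (val s == (u, a))%:R : F^o].
Arguments block_gen {F p K} u a.

(* The structure constants lie in K; iota embeds them in F. *)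
Definition block_br (F : fieldType) (p : nat) (K : finFieldType)
    (iota : {rmorphism K -> F}) (x y : block F p K) : block F p K :=
  \sum_(s : block_index p K) \sum_(t : block_index p K)
    let: (u, a) := val s in let: (v, b) := val t in
    ((x : {ffun _ -> _}) s * (y : {ffun _ -> _}) t
       * iota (Fp_in K v * a - Fp_in K u * b)) *: block_gen (u + v) (a + b).

Lemma block_gen0 (F : fieldType) (p : nat) (K : finFieldType) :
  block_gen 0 0 = 0 :> block F p K.
Proof. by apply/ffunP => s; rewrite !ffunE (negPf (valP s)). Qed.

Lemma block_br_gen (F : fieldType) (p : nat) (K : finFieldType)
    (iota : {rmorphism K -> F}) (u v : 'F_p) (a b : K) :
  block_br iota (block_gen u a) (block_gen v b) =
    iota (Fp_in K v * a - Fp_in K u * b) *: block_gen (u + v) (a + b).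
Proof.
case: (eqVneq (u, a) 0) => [[-> ->]|nz_ua].
  rewrite /Fp_in mulr0 mul0r subrr rmorph0 scale0r /block_br.
  rewrite big1 // => -[[c d] /= nz] _; rewrite big1 // => -[[c' d'] /= nz'] _.
  by rewrite ffunE /= (negPf nz) !mul0r scale0r.
case: (eqVneq (v, b) 0) => [[-> ->]|nz_vb].
  rewrite /Fp_in mulr0 mul0r subrr rmorph0 scale0r /block_br.
  rewrite big1 // => -[[c d] /= nz] _; rewrite big1 // => -[[c' d'] /= nz'] _.
  by rewrite !ffunE /= (negPf nz') mulr0 mul0r scale0r.
rewrite /block_br (bigD1 (exist (fun s : 'F_p * K => s != 0) _ nz_ua : block_index p K)) //= [X in _ + X]big1 ?addr0; last first.
  case=> -[c d] /= nz; rewrite -val_eqE /= => ne; rewrite big1 // => -[[c' d'] /= nz'] _.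
  by rewrite !ffunE /= (negPf ne) !mul0r scale0r.
rewrite (bigD1 (exist (fun s : 'F_p * K => s != 0) _ nz_vb : block_index p K)) //= big1 ?addr0; last first.
  case=> -[c d] /= nz; rewrite -val_eqE /= => ne.
  by rewrite !ffunE /= (negPf ne) mulr0 mul0r scale0r.
by rewrite !ffunE /= !eqxx !mul1r.
Qed.

Section HamiltonBasis.
Variables (F : fieldType) (p n2 : nat).
Notation q := (p ^ n2)%N.
Notation VF := (vfield F p 1 n2).

(* e_{1-j,a} for 1 <= j <= q-1. *)
Definition ham_e1 (j : nat) (a : 'F_p) : VF :=
  ham (j%:R *: mon p.-1 j + \sum_(0 <= i < p) Fp_in F a ^+ i *: mon i j).

(* e_{k,a} for k modulo q-1: here j is the representative of 1 - k in [1, q-1]. *)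
Definition ham_e (k : int) (a : 'F_p) : VF :=
  ham_e1 (`|((- k) %% (q.-1)%:Z)%Z|%N).+1 a.

(* ebar_{1,a}; the sum is 0 for a = 0. *)
Definition ham_ebar (a : 'F_p) : VF :=
  ham (\sum_(1 <= i < p) Fp_in F a ^+ i *: (mon i 0 - i%:R *: mon i q.-1)).

Lemma ham_eE j a : (0 < j < q)%N -> ham_e (1 - j%:Z) a = ham_e1 j a.
Proof.
case: j => // j /= jq; rewrite /ham_e opprB -predn_int //=.
rewrite modz_nat absz_nat modn_small //.
by case: q jq.
Qed.

Definition ham_basis : seq VF :=
  [seq ham_e (1 - j%:Z) a | j <- iota 1 q.-1, a <- enum 'F_p]
  ++ [seq ham_ebar a | a <- enum 'F_p & a != 0].

End HamiltonBasis.
Arguments ham_e {F p n2} k a.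
Arguments ham_ebar {F p n2} a.

(* Main.v *)
Require Import Defs.
From HB Require Import structures.
From mathcomp Require Import all_boot all_order all_algebra all_field ring.
Set Implicit Arguments.
Unset Strict Implicit.
Unset Printing Implicit Defensive.
Import GRing.Theory.
Local Open Scope ring_scope.

(**
Let E_a(x) = \sum a^i x^(i) and E_c(y) = \sum c^j y^(j) be the truncated
exponentials.  With c = b / eps one has c^q = - c, and up to a constant
tau(f_{a,b}) = eps G_{a,c}, where
G_{a,c} = E_a(x) E_c(y) (1 + c y xbar - a x ybar).
As E_a' = E_a a (1 - xbar) and E_c' = E_c c (1 + ybar), multiplicativity
of the exponentials gives {G_{a,c}, G_{b,d}} = (b c - a d) G_{a+b,c+d}, so tau
preserves brackets.  Vandermonde inversion, in b for fixed a and in a for fixed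
y-degree, shows that the images span the Hamiltonian derivations ham f; the
dimension pq - 1 then yields injectivity and the basis.  Finally, the bracket of
two derivations D, E annihilating (1 - e) dx /\ dy is
ham (- (1 - e) (D_1 E_2 - D_2 E_1)), so the first derived algebra consists of
Hamiltonian derivations; these form a perfect algebra because the Block algebra
is perfect, hence they make up the second derived algebra.
*)

(** * The ring identity behind the bracket of two exponential generators *)

(* xb, yb stand for xbar, ybar, and X, Y for their derivatives; the two factors of
   each product are the logarithmic parts of the derivatives of G_{a,c}, G_{b,d}. *)
Lemma poisson_identity (R : comPzRingType) (a b c d x y xb yb X Y : R) :
    xb * xb = 0 -> yb * yb = 0 -> x * xb = 0 -> y * yb = 0 ->
    x * X = - xb -> y * Y = - yb ->
    y * y * (X * xb) = 0 -> x * x * (Y * yb) = 0 ->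
  let s := c * y * xb - a * x * yb in let t := d * y * xb - b * x * yb in
  (c * (1 + yb) * (1 + s) + (c * xb - a * x * Y))
    * (b * (1 - xb) * (1 + t) + (d * y * X - b * yb))
  - (a * (1 - xb) * (1 + s) + (c * y * X - a * yb))
    * (d * (1 + yb) * (1 + t) + (d * xb - b * x * Y))
  = (b * c - a * d) * (1 + s + t) * (1 - xb * yb).
Proof.
move=> xx yy xxb yyb xX yY yyX xxY.
(* Each of [xb], [yb], [y * X], [x * Y] kills every element of the form of [s] and [t]. *)
have xz u v : xb * (u * y * xb - v * x * yb) = 0.
  have -> : xb * (u * y * xb - v * x * yb) = u * y * (xb * xb) - v * yb * (x * xb).
    by ring.
  by rewrite xx xxb !mulr0 subr0.
have yz u v : yb * (u * y * xb - v * x * yb) = 0.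
  have -> : yb * (u * y * xb - v * x * yb) = u * xb * (y * yb) - v * x * (yb * yb).
    by ring.
  by rewrite yy yyb !mulr0 subr0.
have Xz u v : y * X * (u * y * xb - v * x * yb) = 0.
  have -> : y * X * (u * y * xb - v * x * yb)
    = u * (y * y * (X * xb)) - v * X * x * (y * yb) by ring.
  by rewrite yyX yyb !mulr0 subr0.
have Yz u v : x * Y * (u * y * xb - v * x * yb) = 0.
  have -> : x * Y * (u * y * xb - v * x * yb)
    = u * Y * y * (x * xb) - v * (x * x * (Y * yb)) by ring.
  by rewrite xxY xxb !mulr0 subr0.
have UV : x * Y * (y * X) = xb * yb.
  by rewrite -[RHS]mulrNN -xX -yY; ring.
move=> s t.
have [xs xt ys yt] : [/\ xb * s = 0, xb * t = 0, yb * s = 0 & yb * t = 0].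
  by rewrite !xz !yz.
have [Xs Xt Ys Yt] : [/\ y * X * s = 0, y * X * t = 0, x * Y * s = 0 & x * Y * t = 0].
  by rewrite !Xz !Yz.
have st : s * t = 0.
  have -> : s * t = c * y * (xb * t) - a * x * (yb * t) by rewrite {1}/s; ring.
  by rewrite xt yt !mulr0 subr0.
clearbody s t.
have -> : c * (1 + yb) * (1 + s) + (c * xb - a * x * Y)
    = c * (1 + yb + xb + s) - a * (x * Y) + c * (yb * s) by ring.
have -> : b * (1 - xb) * (1 + t) + (d * y * X - b * yb)
    = b * (1 - xb - yb + t) + d * (y * X) - b * (xb * t) by ring.
have -> : a * (1 - xb) * (1 + s) + (c * y * X - a * yb)
    = a * (1 - xb - yb + s) + c * (y * X) - a * (xb * s) by ring.
have -> : d * (1 + yb) * (1 + t) + (d * xb - b * x * Y)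
    = d * (1 + yb + xb + t) - b * (x * Y) + d * (yb * t) by ring.
rewrite xs xt ys yt !mulr0 !addr0 !subr0.
(* Outside the first group every term contains a product known to vanish; inside it, [UV] turns
   minus twice [xb * yb] into minus [xb * yb]. *)
transitivity ((b * c - a * d) * (1 + s + t - xb * xb - yb * yb - (xb * yb) *+ 2
                + x * Y * (y * X) + s * t)
  + (b * c + a * d) * (xb * t + yb * t - xb * s - yb * s)
  + c * d * (y * X * s - y * X * t) + a * b * (x * Y * s - x * Y * t)).
  ring.
rewrite xx yy st UV xs xt ys yt Xs Xt Ys Yt.
have -> : (b * c - a * d) * (1 + s + t) * (1 - xb * yb)
  = (b * c - a * d) * (1 + s + t - xb * yb - yb * (xb * s) - yb * (xb * t)).
  by ring.
rewrite xs xt; ring.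
Qed.

(** * Vandermonde inversion *)

(** The nodes [z t] are distinct, so their Vandermonde matrix is invertible, and its inverse
    recovers each [m i] from the given sums. *)
Lemma mem_power_sums (F : fieldType) (V : vectType F) (W : {vspace V})
    (T : finType) (z : T -> F) (m : nat -> V) :
    injective z -> (forall t, \sum_(0 <= i < #|T|) z t ^+ i *: m i \in W) ->
  forall i, (i < #|T|)%N -> m i \in W.
Proof.
move=> zinj mW i ltiT.
pose M := Vandermonde #|T| (\row_j z (enum_val j)) : 'M_#|T|.
have Mu : M \in unitmx.
  rewrite unitmxE det_Vandermonde unitfE.
  apply/prodf_neq0 => j _; apply/prodf_neq0 => k ltjk; rewrite !mxE subr_eq0.
  by rewrite (inj_eq zinj) (inj_eq enum_val_inj) eq_sym -val_eqE neq_ltn ltjk.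
have -> : m i = \sum_(j < #|T|) invmx M j (Ordinal ltiT) *:
                  (\sum_(0 <= k < #|T|) z (enum_val j) ^+ k *: m k).
  under eq_bigr => j _ do rewrite big_mkord scaler_sumr.
  rewrite exchange_big /= (bigD1 (Ordinal ltiT)) //= [X in _ + X]big1 ?addr0.
    under eq_bigr => j _ do rewrite scalerA mulrC.
    rewrite -scaler_suml; have /matrixP/(_ (Ordinal ltiT) (Ordinal ltiT)) := mulmxV Mu.
    rewrite !mxE eqxx => E; rewrite -[LHS]scale1r -[1]E; congr (_ *: _).
    by apply: eq_bigr => j _; rewrite !mxE.
  move=> k nki; under eq_bigr => j _ do rewrite scalerA mulrC.
  rewrite -scaler_suml; have /matrixP/(_ k (Ordinal ltiT)) := mulmxV Mu.
  rewrite !mxE (negPf nki) => E; rewrite -[RHS](scale0r (m k)) -[0 in RHS]E.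
  by congr (_ *: _); apply: eq_bigr => j _; rewrite !mxE.
by apply: memv_suml => j _; rewrite memvZ.
Qed.

(** * Truncated exponentials of divided power sequences *)

(** This is the binomial theorem; the pairs of degrees with [N <= i + k], absent on the right,
    contribute zero on the left. *)
Lemma truncexpM (R : comPzRingType) (N : nat) (m : nat -> R) :
    (forall i, (N <= i)%N -> m i = 0) ->
    (forall i k, m i * m k = 'C(i + k, i)%:R * m (i + k)%N) ->
  forall a b : R,
    (\sum_(0 <= i < N) a ^+ i * m i) * (\sum_(0 <= i < N) b ^+ i * m i)
    = \sum_(0 <= i < N) (a + b) ^+ i * m i.
Proof.
move=> m0 mM a b; rewrite mulrC mulr_suml !big_mkord.
have -> : \sum_(n < N) (a + b) ^+ n * m n
  = \sum_(n < N) \sum_(i < N | (i < n.+1)%N)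
      (a ^+ (n - i) * b ^+ i *+ 'C(n, i)) * m n.
  apply: eq_bigr => n _; rewrite exprDn mulr_suml.
  by rewrite (big_ord_widen N (fun i => (a ^+ (n - i) * b ^+ i *+ 'C(n, i)) * m n)).
rewrite [RHS](exchange_big_dep predT) //=; apply: eq_bigr => i _.
rewrite big_distrr /=.
rewrite -(big_mkord (fun n => i < n.+1)%N
  (fun n => (a ^+ (n - i) * b ^+ i *+ 'C(n, i)) * m n)).
rewrite -(big_mkord predT (fun k => b ^+ i * m i * (a ^+ k * m k))).
rewrite [RHS](big_cat_nat (n := i)) ?(ltnW (ltn_ord i)) //=.
rewrite [X in _ = X + _]big_nat_cond [X in _ = X + _]big_pred0; last first.
  by move=> n; rewrite ltnS; case: ltnP; rewrite ?andbF.
rewrite add0r big_nat_cond [RHS]big_nat_cond.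
rewrite [RHS](eq_bigl (fun n => (i <= n < N)%N && true)); last first.
  by move=> n; rewrite ltnS; case: (i <= n)%N; rewrite ?andbT ?andbF.
rewrite -!big_nat_cond -{3}[val i]add0n big_addn.
rewrite (big_cat_nat (n := (N - i)%N)) ?leq_subr //=.
rewrite [X in _ + X]big_nat [X in _ + X]big1 ?addr0; last first.
  move=> k /andP[lek _]; rewrite mulrACA mM m0 ?mulr0 //.
  by rewrite -leq_subLR.
apply: eq_bigr => k _; rewrite mulrACA mM addnK addnC.
by rewrite -[(_ * _) *+ _]mulr_natr; ring.
Qed.

(** Differentiation shifts the index by one; the shift does not reach the last summand
    [a ^+ N * m N.-1] of [a] times the exponential. *)
Lemma truncexp_diff (R : comPzRingType) (N : nat) (d : {additive R -> R})
    (m : nat -> R) (a : R) :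
    (0 < N)%N -> (forall i f, d (a ^+ i * f) = a ^+ i * d f) -> d (m 0%N) = 0 ->
    (forall i, (i.+1 < N)%N -> d (m i.+1) = m i) ->
  d (\sum_(0 <= i < N) a ^+ i * m i)
  = a * (\sum_(0 <= i < N) a ^+ i * m i) - a ^+ N * m N.-1.
Proof.
case: N => // N _ da d0 dS; rewrite raddf_sum big_nat_recl //= da d0 mulr0 add0r.
rewrite [in RHS]big_nat_recr //= mulrDr mulrA -exprS addrK mulr_sumr.
by rewrite !big_nat; apply: eq_bigr => i ltiN; rewrite da dS // mulrA -exprS.
Qed.

(** As [m 1 * m i] is [i + 1] times [m (i + 1)], multiplying the exponential by [a * m 1] acts as
    the Euler operator. This produces the weights [i] and [j] in the formulas for tau. *)
Lemma truncexp_euler (R : comPzRingType) (N : nat) (m : nat -> R) (a : R) :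
    (forall i, (N <= i)%N -> m i = 0) ->
    (forall i k, m i * m k = 'C(i + k, i)%:R * m (i + k)%N) ->
  a * m 1%N * (\sum_(0 <= i < N) a ^+ i * m i)
  = \sum_(0 <= i < N) i%:R * a ^+ i * m i.
Proof.
move=> m0 mM; case: N m0 => [|N] m0; first by rewrite !big_geq ?mulr0.
rewrite big_nat_recr // [RHS]big_nat_recl //= mul0r mul0r add0r mulrDr.
rewrite [X in _ + X]mulrACA mM add1n (m0 N.+1) ?mulr0 ?addr0 // big_distrr /=.
apply: eq_bigr => i _; rewrite mulrACA mM add1n bin1 -exprS; ring.
Qed.

(** * Brackets of exponentials in a ring with two derivations *)

Section PoissonExponentials.
Variables (R : comPzRingType) (dx dy : {additive R -> R}).
Hypothesis dxM : forall f g, dx (f * g) = dx f * g + f * dx g.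
Hypothesis dyM : forall f g, dy (f * g) = dy f * g + f * dy g.
Variables (P Q : nat) (mx my : nat -> R).
Hypotheses (P_gt1 : (1 < P)%N) (Q_gt1 : (1 < Q)%N).
Hypotheses (P0 : P%:R = 0 :> R) (Q0 : Q%:R = 0 :> R).
Hypotheses (mx0 : mx 0%N = 1) (my0 : my 0%N = 1).
Hypothesis mxP : forall i, (P <= i)%N -> mx i = 0.
Hypothesis myQ : forall j, (Q <= j)%N -> my j = 0.
Hypothesis mxM : forall i k, mx i * mx k = 'C(i + k, i)%:R * mx (i + k)%N.
Hypothesis myM : forall j l, my j * my l = 'C(j + l, j)%:R * my (j + l)%N.
Hypothesis dx_mx : forall i, (i.+1 < P)%N -> dx (mx i.+1) = mx i.
Hypothesis dy_my : forall j, (j.+1 < Q)%N -> dy (my j.+1) = my j.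
Hypothesis dx_my : forall j, dx (my j) = 0.
Hypothesis dy_mx : forall i, dy (mx i) = 0.

Local Notation xb := (mx P.-1).
Local Notation yb := (my Q.-1).
Local Notation expx a := (\sum_(0 <= i < P) a ^+ i * mx i).
Local Notation expy c := (\sum_(0 <= j < Q) c ^+ j * my j).

(** The element [G_{a,c}], with [mx i] and [my j] in the role of [x^(i)] and [y^(j)]. *)
Definition exp_gen (a c : R) : R :=
  expx a * expy c * (1 + c * my 1%N * xb - a * mx 1%N * yb).

Lemma top_annihilates (N : nat) (m : nat -> R) i :
    (0 < N)%N -> (forall i, (N <= i)%N -> m i = 0) ->
    (forall i k, m i * m k = 'C(i + k, i)%:R * m (i + k)%N) ->
  (0 < i)%N -> m i * m N.-1 = 0.
Proof.
move=> N_gt0 m0 mM i_gt0; rewrite mM m0 ?mulr0 //.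
by rewrite -(prednK i_gt0) addSnnS (prednK N_gt0) leq_addl.
Qed.

(** The top power pushes all terms of positive degree out of range. Hence [xb] and [yb] can absorb
    or release an exponential. *)
Lemma truncexp_top (N : nat) (m : nat -> R) (a : R) :
    (0 < N)%N -> m 0%N = 1 -> (forall i, (N <= i)%N -> m i = 0) ->
    (forall i k, m i * m k = 'C(i + k, i)%:R * m (i + k)%N) ->
  (\sum_(0 <= i < N) a ^+ i * m i) * m N.-1 = m N.-1.
Proof.
move=> N_gt0 m1 m0 mM; rewrite mulr_suml -{1}(prednK N_gt0) big_nat_recl //=.
rewrite expr0 mul1r m1 mul1r.
by rewrite big1 ?addr0 // => i _; rewrite -mulrA top_annihilates ?mulr0.
Qed.

(** Scalars are modelled inside the ring, so that the computations are identities in one commutative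
    ring. *)
Definition is_constant (a : R) := dx a = 0 /\ dy a = 0.

Lemma constX a i : is_constant a -> is_constant (a ^+ i).
Proof.
case=> ax ay; elim: i => [|i [IHx IHy]].
  rewrite expr0; split.
    by apply: (@addrI _ (dx 1)); rewrite addr0 -[in RHS](mulr1 1) dxM mulr1 mul1r.
  by apply: (@addrI _ (dy 1)); rewrite addr0 -[in RHS](mulr1 1) dyM mulr1 mul1r.
by split; rewrite exprS ?dxM ?dyM ?ax ?ay ?IHx ?IHy mulr0 mul0r addr0.
Qed.

Lemma const1 : is_constant 1.
Proof.
by have := @constX 0 0; rewrite expr0; apply; split; rewrite raddf0. Qed.

Lemma dx_constl a f : is_constant a -> dx (a * f) = a * dx f.
Proof. by case=> ax _; rewrite dxM ax mul0r add0r. Qed.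

Lemma dy_constl a f : is_constant a -> dy (a * f) = a * dy f.
Proof. by case=> _ ay; rewrite dyM ay mul0r add0r. Qed.

(** The product has coefficient [P - 1], which is [-1] because [P = 0] in [R]. *)
Lemma dx_top : mx 1%N * dx xb = - xb.
Proof.
have P2 : P = P.-2.+2 by case: P P_gt1 => [|[]].
rewrite P2 /= dx_mx -?P2 // mxM add1n bin1 -[_%:R]subr0 -P0 P2 [in P.-2.+2%:R]mulrS.
ring.
Qed.

Lemma dy_top : my 1%N * dy yb = - yb.
Proof.
have Q2 : Q = Q.-2.+2 by case: Q Q_gt1 => [|[]].
rewrite Q2 /= dy_my -?Q2 // myM add1n bin1 -[_%:R]subr0 -Q0 Q2 [in Q.-2.+2%:R]mulrS.
ring.
Qed.

(** The degree [2 P - 3] of [dx xb * xb] is in range only for [P = 2], so this case needs the other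
    variable. *)
Hypothesis residual_x : my 1%N * my 1%N * (dx xb * xb) = 0.
Hypothesis residual_y : mx 1%N * mx 1%N * (dy yb * yb) = 0.

(** By [a ^+ P = a] the defect in [truncexp_diff] is [a * xb], which equals [a * xb * expx a]; so
    the exponential still factors out, with cofactor [a * (1 - xb)]. *)
Lemma dx_exp_gen a c : is_constant a -> is_constant c -> a ^+ P = a ->
  dx (exp_gen a c) = expx a * expy c *
    (a * (1 - xb) * (1 + (c * my 1%N * xb - a * mx 1%N * yb))
     + (c * my 1%N * dx xb - a * yb)).
Proof.
move=> ca cc aP; have P_gt0 := ltnW P_gt1.
have ex : dx (expx a) = expx a * (a * (1 - xb)).
  rewrite truncexp_diff //; last 2 first.
  - by move=> i f; rewrite dx_constl //; apply: constX.
  - by rewrite mx0; case: const1.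
  rewrite aP -{1}(truncexp_top a P_gt0 mx0 mxP mxM); ring.
have ey : dx (expy c) = 0.
  rewrite raddf_sum big1 // => j _; rewrite dx_constl ?dx_my ?mulr0 //.
  exact: constX.
have -> : dx (exp_gen a c) = expy c * dx (expx a) * (1 + c * my 1%N * xb - a * mx 1%N * yb)
   + expx a * dx (expy c) * (1 + c * my 1%N * xb - a * mx 1%N * yb)
   + expx a * expy c * (dx (1 + c * my 1%N * xb - a * mx 1%N * yb)).
  by rewrite /exp_gen !dxM; ring.
rewrite ex ey raddfB raddfD -!mulrA (dx_constl _ cc) (dx_constl _ ca).
rewrite !dxM !dx_my (proj1 const1).
rewrite dx_mx // mx0; ring.
Qed.

(** The sign in [c ^+ Q = - c] reverses the defect, whence [1 + yb] here against [1 - xb] for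
    [dx]. *)
Lemma dy_exp_gen a c : is_constant a -> is_constant c -> c ^+ Q = - c ->
  dy (exp_gen a c) = expx a * expy c *
    (c * (1 + yb) * (1 + (c * my 1%N * xb - a * mx 1%N * yb))
     + (c * xb - a * mx 1%N * dy yb)).
Proof.
move=> ca cc cQ; have Q_gt0 := ltnW Q_gt1.
have ey : dy (expy c) = expy c * (c * (1 + yb)).
  rewrite truncexp_diff //; last 2 first.
  - by move=> i f; rewrite dy_constl //; apply: constX.
  - by rewrite my0; case: const1.
  rewrite cQ -{1}(truncexp_top c Q_gt0 my0 myQ myM); ring.
have ex : dy (expx a) = 0.
  rewrite raddf_sum big1 // => j _; rewrite dy_constl ?dy_mx ?mulr0 //.
  exact: constX.
have -> : dy (exp_gen a c) = expy c * dy (expx a) * (1 + c * my 1%N * xb - a * mx 1%N * yb)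
   + expx a * dy (expy c) * (1 + c * my 1%N * xb - a * mx 1%N * yb)
   + expx a * expy c * (dy (1 + c * my 1%N * xb - a * mx 1%N * yb)).
  by rewrite /exp_gen !dyM; ring.
rewrite ex ey raddfB raddfD -!mulrA (dy_constl _ cc) (dy_constl _ ca).
rewrite !dyM !dy_mx (proj2 const1).
rewrite dy_my // my0; ring.
Qed.

(** The four exponentials factor out and leave [poisson_identity]. On the right they merge by
    [truncexpM], and the last factor is [1 + s + t] because [s] is additive in the pair [a], [c]. *)
Lemma poisson_exp_gen a b c d :
    is_constant a -> is_constant b -> is_constant c -> is_constant d ->
    a ^+ P = a -> b ^+ P = b -> c ^+ Q = - c -> d ^+ Q = - d ->
  dy (exp_gen a c) * dx (exp_gen b d) - dx (exp_gen a c) * dy (exp_gen b d)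
  = (b * c - a * d) * exp_gen (a + b) (c + d) * (1 - xb * yb).
Proof.
move=> ca cb cc cd aP bP cQ dQ.
rewrite !dx_exp_gen // !dy_exp_gen //.
have := @poisson_identity R a b c d (mx 1%N) (my 1%N) xb yb (dx xb) (dy yb).
have [P_gt0 Q_gt0] := (ltnW P_gt1, ltnW Q_gt1).
have [P1_gt0 Q1_gt0] : (0 < P.-1)%N /\ (0 < Q.-1)%N by rewrite -!subn1 !subn_gt0.
rewrite !top_annihilates // dx_top dy_top.
move=> /(_ erefl erefl erefl erefl erefl erefl residual_x residual_y) /= E.
rewrite /exp_gen -(truncexpM mxP mxM) -(truncexpM myQ myM).
transitivity (expx a * expx b * (expy c * expy d) *
   ((b * c - a * d) * (1 + (c * my 1%N * xb - a * mx 1%N * yb) +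
      (d * my 1%N * xb - b * mx 1%N * yb)) * (1 - xb * yb))).
  by rewrite -E; ring.
ring.
Qed.

(** Since [xb] absorbs [expx a], the term with [c * my 1 * xb] leaves only the Euler sum in [y], and
    symmetrically for [yb]. *)
Lemma exp_gen_expand a c :
  exp_gen a c = expx a * expy c
    + (\sum_(0 <= j < Q) j%:R * c ^+ j * my j) * xb
    - (\sum_(0 <= i < P) i%:R * a ^+ i * mx i) * yb.
Proof.
rewrite -(truncexp_euler c myQ myM) -(truncexp_euler a mxP mxM).
rewrite -{1}(truncexp_top a (ltnW P_gt1) mx0 mxP mxM).
rewrite -{1}(truncexp_top c (ltnW Q_gt1) my0 myQ myM) /exp_gen.
ring.
Qed.

End PoissonExponentials.

(** * The exponentials in the divided power algebra *)

Section DividedPowerExponentials.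
Variables (F : fieldType) (p n1 n2 : nat).
Hypotheses (charFp : p \in [pchar F]) (n1_gt0 : (0 < n1)%N) (n2_gt0 : (0 < n2)%N).
Notation DP := (divpow F p n1 n2).
Notation P := (p ^ n1)%N.
Notation Q := (p ^ n2)%N.

(** Turns scaling into multiplication, as the abstract lemmas and [ring] require. *)
Definition dp_const (a : F) : DP := a *: (1 : DP).

Lemma dp_scaleE (a : F) (f : DP) : a *: f = dp_const a * f.
Proof. by rewrite /dp_const dp_scaleAl mul1r. Qed.

Lemma dp_constD a b : dp_const (a + b) = dp_const a + dp_const b.
Proof. exact: scalerDl. Qed.

Lemma dp_constB a b : dp_const (a - b) = dp_const a - dp_const b.
Proof. exact: scalerBl. Qed.

Lemma dp_constM a b : dp_const (a * b) = dp_const a * dp_const b.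
Proof. by rewrite -dp_scaleE /dp_const scalerA. Qed.

Lemma dp_constN a : dp_const (- a) = - dp_const a.
Proof. exact: scaleNr. Qed.

Lemma dp_constX a i : dp_const (a ^+ i) = dp_const a ^+ i.
Proof.
by elim: i => [|i IH]; rewrite ?exprS ?dp_constM ?IH // /dp_const expr0 scale1r.
Qed.

Lemma dp_const_nat k : dp_const k%:R = k%:R.
Proof. exact: scaler_nat. Qed.

Lemma mon_mon i j k l :
  mon i j * mon k l = ('C(i + k, i) * 'C(j + l, j))%:R * mon (i + k) (j + l) :> DP.
Proof. by rewrite -dp_const_nat -dp_scaleE; apply: dpmul_mon. Qed.

Definition dp_exp (a c : F) : DP :=
  exp_gen P Q (fun i => mon i 0) (fun j => mon 0 j) (dp_const a) (dp_const c).

Let P_gt1 : (1 < P)%N.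
Proof. by rewrite -(exp1n n1) ltn_exp2r ?prime_gt1 ?(pcharf_prime charFp). Qed.

Let Q_gt1 : (1 < Q)%N.
Proof. by rewrite -(exp1n n2) ltn_exp2r ?prime_gt1 ?(pcharf_prime charFp). Qed.

Lemma pexp_nat0 n : (0 < n)%N -> (p ^ n)%:R = 0 :> DP.
Proof.
move=> n_gt0; rewrite -dp_const_nat natrX (pcharf0 charFp) expr0n.
by case: n n_gt0 => // n _; exact: scale0r.
Qed.

Let mon0 : mon 0 0 = 1 :> DP. Proof. by []. Qed.

Let monx0 i : (P <= i)%N -> mon i 0 = 0 :> DP.
Proof. by move=> h; rewrite mon_oversize ?h. Qed.

Let mony0 j : (Q <= j)%N -> mon 0 j = 0 :> DP.
Proof. by move=> h; rewrite mon_oversize ?h ?orbT. Qed.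

Let monxM i k : mon i 0 * mon k 0 = 'C(i + k, i)%:R * mon (i + k) 0 :> DP.
Proof. by rewrite mon_mon muln1. Qed.

Let monyM j l : mon 0 j * mon 0 l = 'C(j + l, j)%:R * mon 0 (j + l) :> DP.
Proof. by rewrite mon_mon mul1n. Qed.

Let monxy i j : mon i j = mon i 0 * mon 0 j :> DP.
Proof. by rewrite mon_mon addn0 binn bin0 mul1r. Qed.

Lemma dp_const_const a :
  is_constant (@ddx F p n1 n2) (@ddy F p n1 n2) (dp_const a).
Proof.
split.
  by change (ddx (a *: mon 0 0 : DP) = 0); rewrite linearZ /= ddx_mon ?scaler0 // ltnW.
by change (ddy (a *: mon 0 0 : DP) = 0); rewrite linearZ /= ddy_mon ?scaler0 // ltnW.
Qed.

(* Only at p^n = 2 can the product x^(p^n-2) x^(p^n-1) survive, and then p = 2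
   kills the square of the other variable. *)
Lemma residual_eq0 (N : nat) (f : DP) (m : nat -> DP) : (0 < N)%N ->
    (forall i, (p ^ N <= i)%N -> m i = 0) ->
    (forall i k, m i * m k = 'C(i + k, i)%:R * m (i + k)%N) ->
    f * f = 2%:R * mon 2 0 \/ f * f = 2%:R * mon 0 2 ->
  f * f * (m (p ^ N).-2 * m (p ^ N).-1) = 0.
Proof.
move=> N_gt0 m0 mM ff.
have [pN2 | pN2] := eqVneq (p ^ N)%N 2.
  have : 2%:R = 0 :> DP by have := pexp_nat0 N_gt0; rewrite pN2.
  by move=> two0; case: ff => ->; rewrite two0 !mul0r.
have pN : (2 < p ^ N)%N.
  rewrite ltn_neqAle eq_sym pN2 -(exp1n N) ltn_exp2r ?prime_gt1 //.
  exact: pcharf_prime charFp.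
rewrite mM m0 ?mulr0 //; case: (p ^ N)%N pN => [|[|[|k']]] //= _.
by rewrite addnS !addSn !ltnS leq_addl.
Qed.

Lemma poisson_dp_exp (a b c d : F) :
    a ^+ P = a -> b ^+ P = b -> c ^+ Q = - c -> d ^+ Q = - d ->
  poisson (dp_exp a c) (dp_exp b d) = (b * c - a * d) *: dp_exp (a + b) (c + d).
Proof.
move=> aP bP cQ dQ; rewrite /poisson.
have -> : ddy (dp_exp a c) * ddx (dp_exp b d) - ddx (dp_exp a c) * ddy (dp_exp b d)
  = dp_const (b * c - a * d) * dp_exp (a + b) (c + d) * (1 - dpe F p n1 n2).
  rewrite dp_constB !dp_constM /dp_exp !dp_constD /dpe (monxy P.-1).
  apply: (@poisson_exp_gen DP (@ddx F p n1 n2) (@ddy F p n1 n2)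
    (ddxM charFp) (ddyM charFp) P Q (fun i => mon i 0) (fun j => mon 0 j)).
  all: try exact: P_gt1.
  all: try exact: Q_gt1.
  all: try exact: pexp_nat0.
  all: try exact: mon0.
  all: try exact: monx0.
  all: try exact: mony0.
  all: try exact: monxM.
  all: try exact: monyM.
  all: try exact: dp_const_const.
  all: try by rewrite -dp_constX ?cQ ?dQ ?aP ?bP ?dp_constN.
  all: try by move=> i lti; rewrite [LHS]ddx_mon.
  all: try by move=> i lti; rewrite [LHS]ddy_mon.
  - by move=> j; rewrite [LHS]ddx_mon // ltnW.
  - by move=> i; rewrite [LHS]ddy_mon // ltnW.
  - change (mon 0 1 * mon 0 1 * (ddx (mon P.-1 0) * mon P.-1 0) = 0 :> DP).
    rewrite ddx_mon ?prednK ?(ltnW P_gt1) // -subn1 subn_gt0 P_gt1 subn1.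
    apply: (@residual_eq0 n1 (mon 0 1) (fun i => mon i 0)) => //.
    by right; rewrite mon_mon mul1n.
  - change (mon 1 0 * mon 1 0 * (ddy (mon 0 Q.-1) * mon 0 Q.-1) = 0 :> DP).
    rewrite ddy_mon ?prednK ?(ltnW Q_gt1) // -subn1 subn_gt0 Q_gt1 subn1.
    apply: (@residual_eq0 n2 (mon 1 0) (fun j => mon 0 j)) => //.
    by left; rewrite mon_mon muln1.
(* The factor [1 + e] of the Poisson bracket cancels [1 - e], because [e] squares to zero. *)
transitivity (dp_const (b * c - a * d) * dp_exp (a + b) (c + d)
    * ((1 - dpe F p n1 n2) * (1 + dpe F p n1 n2))); first by ring.
by rewrite (dpe_sqr n2 charFp n1_gt0) mulr1 -dp_scaleE.
Qed.

Lemma dp_exp_expand (a c : F) :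
  dp_exp a c = \sum_(0 <= i < P) \sum_(0 <= j < Q) (a ^+ i * c ^+ j) *: mon i j
    + \sum_(0 <= j < Q) (j%:R * c ^+ j) *: mon P.-1 j
    - \sum_(0 <= i < P) (i%:R * a ^+ i) *: mon i Q.-1.
Proof.
rewrite /dp_exp (@exp_gen_expand DP P Q (fun i => mon i 0) (fun j => mon 0 j)
  P_gt1 Q_gt1 mon0 mon0 monx0 mony0 monxM monyM).
congr (_ + _ - _).
- rewrite mulr_suml; apply: eq_bigr => i _; rewrite big_distrr /=.
  apply: eq_bigr => j _.
  by rewrite dp_scaleE dp_constM !dp_constX (monxy i j) mulrACA.
- rewrite mulr_suml; apply: eq_bigr => j _.
  rewrite dp_scaleE dp_constM dp_const_nat dp_constX (monxy P.-1 j).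
  by rewrite -mulrA (mulrC (mon 0 j)).
- rewrite mulr_suml; apply: eq_bigr => i _.
  by rewrite dp_scaleE dp_constM dp_const_nat dp_constX (monxy i Q.-1) mulrA.
Qed.

(** The constant [1] is killed by [ham]; for [n1 = 1] the remaining sum defines [ham_ebar a]. *)
Lemma dp_exp_0 (a : F) :
  dp_exp a 0 = 1 + \sum_(1 <= i < P) a ^+ i *: (mon i 0 - i%:R *: mon i Q.-1).
Proof.
rewrite dp_exp_expand [X in _ + X - _]big1_seq; last first.
  by move=> [|j] _; rewrite ?mul0r ?exprS ?mul0r ?mulr0 scale0r.
have -> : \sum_(0 <= i < P) \sum_(0 <= j < Q) (a ^+ i * 0 ^+ j) *: (mon i j : DP)
    = \sum_(0 <= i < P) a ^+ i *: mon i 0.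
  apply: eq_bigr => i _; rewrite big_ltn ?(ltnW Q_gt1) // expr0 mulr1.
  rewrite big_nat big1 ?addr0 // => -[|j] // _.
  by rewrite exprS mul0r mulr0 scale0r.
rewrite addr0 big_ltn ?(ltnW P_gt1) // [X in _ - X]big_ltn ?(ltnW P_gt1) //.
rewrite expr0 scale1r mul0r scale0r add0r -addrA -sumrB; congr (_ + _).
by apply: eq_bigr => i _; rewrite scalerBr scalerA mulrC.
Qed.

(** The terms with [ybar] coming from the last factor do not involve [c] and cancel, as does the
    part of the double sum of degree zero in [y]. For [n1 = 1] the coefficient of [c ^+ j] is the
    function defining [ham_e1 j a]. *)
Lemma dp_exp_sub (a c : F) :
  dp_exp a c - dp_exp a 0
  = \sum_(1 <= j < Q)
      c ^+ j *: (j%:R *: mon P.-1 j + \sum_(0 <= i < P) a ^+ i *: mon i j).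
Proof.
rewrite dp_exp_0 dp_exp_expand exchange_big /=.
rewrite big_ltn ?(ltnW Q_gt1) //.
rewrite [\sum_(0 <= j < Q) (j%:R * _) *: _]big_ltn ?(ltnW Q_gt1) //.
rewrite mul0r scale0r add0r.
have -> : \sum_(0 <= i < P) (a ^+ i * c ^+ 0) *: (mon i 0 : DP)
    = 1 + \sum_(1 <= i < P) a ^+ i *: mon i 0.
  rewrite big_ltn ?(ltnW P_gt1) // !expr0 mulr1 scale1r; congr (_ + _).
  by apply: eq_bigr => i _; rewrite mulr1.
have -> : \sum_(0 <= i < P) (i%:R * a ^+ i) *: (mon i Q.-1 : DP)
    = \sum_(1 <= i < P) (i%:R * a ^+ i) *: mon i Q.-1.
  by rewrite big_ltn ?(ltnW P_gt1) // mul0r scale0r add0r.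
have -> : \sum_(1 <= i < P) a ^+ i *: (mon i 0 - i%:R *: mon i Q.-1 : DP)
    = \sum_(1 <= i < P) a ^+ i *: mon i 0
      - \sum_(1 <= i < P) (i%:R * a ^+ i) *: mon i Q.-1.
  by rewrite -sumrB; apply: eq_bigr => i _; rewrite scalerBr scalerA mulrC.
under [RHS]eq_bigr => j _ do rewrite scalerDr scaler_sumr scalerA (mulrC (c ^+ j)).
rewrite big_split /=.
have -> : \sum_(1 <= j < Q) \sum_(0 <= i < P) c ^+ j *: (a ^+ i *: (mon i j : DP))
    = \sum_(1 <= j < Q) \sum_(0 <= i < P) (a ^+ i * c ^+ j) *: mon i j.
  by apply: eq_bigr => j _; apply: eq_bigr => i _; rewrite scalerA mulrC.
ring.
Qed.

End DividedPowerExponentials.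

(** * Hamiltonian derivations and the second derived algebra *)

Section HamiltonianSpace.
Variables (F : fieldType) (p n1 n2 : nat).
Hypotheses (charFp : p \in [pchar F]) (n1_gt0 : (0 < n1)%N).
Notation DP := (divpow F p n1 n2).
Notation VF := (vfield F p n1 n2).

Definition ham_space : {vspace VF} := limg (linfun (@ham F p n1 n2)).

Lemma mem_ham (f : DP) : ham f \in ham_space.
Proof. by rewrite -[ham f](lfunE (@ham F p n1 n2)) memv_img ?memvf. Qed.

Lemma ham_spaceP (D : VF) : reflect (exists f : DP, D = ham f) (D \in ham_space).
Proof.
apply: (iffP memv_imgP) => [[f _ ->]|[f ->]]; first by exists f; rewrite lfunE.
by exists f; rewrite ?memvf ?lfunE.
Qed.

Lemma ham1 : ham (1 : DP) = 0.
Proof. by apply/eqP; rewrite (ham_eq0 charFp n1_gt0) memv_line. Qed.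

(** Rank-nullity: the kernel of [ham] is the line of constants. *)
Lemma dim_ham_space : \dim ham_space = (p ^ n1 * p ^ n2).-1.
Proof.
have := limg_ker_dim (linfun (@ham F p n1 n2)) fullv.
have -> : (fullv :&: lker (linfun (@ham F p n1 n2)))%VS = <[1 : DP]>%VS.
  by rewrite capfv; apply/vspaceP => f; rewrite memv_ker lfunE /= (ham_eq0 charFp n1_gt0).
have -> : \dim {: DP} = (p ^ n1 * p ^ n2)%N by rewrite dimvf; apply: dim_matrix.
rewrite -/ham_space dim_vline => <-.
suff -> : (1 : DP) != 0 by [].
have p_gt0 := prime_gt0 (pcharf_prime charFp).
have r : (0 < p ^ n1)%N by rewrite expn_gt0 p_gt0.
have s : (0 < p ^ n2)%N by rewrite expn_gt0 p_gt0.
apply/eqP => one0; have := @monE F p n1 n2 0 0 (Ordinal r) (Ordinal s).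
rewrite /= (_ : mon 0 0 = 0 :> DP) //.
by rewrite /dpcoef [LHS]mxE => /eqP; rewrite eq_sym oner_eq0.
Qed.

(** When [D] and [E] annihilate a 2-form in two variables, contracting it with their bracket gives,
    up to sign, the differential of its value on [D], [E]; that value is the function in the
    witness. *)
Lemma vf_br_annihilator2 (D E : VF) :
    D \in annihilator2 (1 - dpe F p n1 n2) -> E \in annihilator2 (1 - dpe F p n1 n2) ->
  vf_br D E \in ham_space.
Proof.
rewrite !mem_annihilator2 => /eqP hD /eqP hE; apply/ham_spaceP.
exists (- ((1 - dpe F p n1 n2) * (D.1 * E.2 - D.2 * E.1))).
have := dpe_sqr n2 charFp n1_gt0; move: hD hE; rewrite /ham /vf_br /vf_lie2 /vf_act.
set u := 1 - dpe F p n1 n2; set v := 1 + dpe F p n1 n2.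
move: D E => [D1 D2] [E1 E2] /= hD hE uv; clearbody u v.
have vK (f g : DP) : u * f = g -> f = v * g.
  by move=> <-; rewrite mulrA (mulrC v) uv mul1r.
(* After multiplication by the unit [u], the two sides differ by a combination of the vanishing
   expressions [hD] and [hE]. *)
rewrite -[- (v * _)]mulrN; congr (_, _); apply: vK; apply/eqP; rewrite -subr_eq0; apply/eqP.
  rewrite linearN /= (ddyM charFp) linearB /= !(ddyM charFp).
  transitivity (D1 * (E1 * ddx u + E2 * ddy u + u * (ddx E1 + ddy E2))
                - E1 * (D1 * ddx u + D2 * ddy u + u * (ddx D1 + ddy D2))); first by ring.
  by rewrite hD hE !mulr0 subr0.
rewrite opprK linearN /= (ddxM charFp) linearB /= !(ddxM charFp).
transitivity (D2 * (E1 * ddx u + E2 * ddy u + u * (ddx E1 + ddy E2))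
              - E2 * (D1 * ddx u + D2 * ddy u + u * (ddx D1 + ddy D2))); first by ring.
by rewrite hD hE !mulr0 subr0.
Qed.

Lemma mem_derived (U : {vspace VF}) (D E : VF) :
  D \in U -> E \in U -> vf_br D E \in derived (@vf_br F p n1 n2) U.
Proof.
have /derived_subvP := subvv (derived (@vf_br F p n1 n2) U).
by apply => [u|v]; [exact: vf_br_linearr | exact: vf_br_linearl].
Qed.

Lemma derivedS (U W : {vspace VF}) :
  (U <= W)%VS -> (derived (@vf_br F p n1 n2) U <= derived (@vf_br F p n1 n2) W)%VS.
Proof.
move=> /subvP sUW; apply/derived_subvP => [u|v|u v uU vU].
- exact: vf_br_linearr.
- exact: vf_br_linearl.
- by rewrite mem_derived ?sUW.
Qed.

(** The first derived algebra of [A] lies in [ham_space], hence so does the second; perfectness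
    keeps [ham_space] inside both. *)
Lemma hamilton2_ham_space :
  (ham_space <= derived (@vf_br F p n1 n2) ham_space)%VS ->
  hamilton2 F p n1 n2 = ham_space.
Proof.
move=> perf; rewrite /hamilton2; set A := annihilator2 _.
have sHA : (ham_space <= A)%VS.
  by apply/subvP => D /ham_spaceP[f ->]; exact: ham_annihilator2.
have sAH : (derived (@vf_br F p n1 n2) A <= ham_space)%VS.
  apply/derived_subvP => [u|v|u v uU vU].
  - exact: vf_br_linearr.
  - exact: vf_br_linearl.
  - exact: vf_br_annihilator2.
apply/eqP; rewrite eqEsubv; apply/andP; split.
  exact: (subv_trans (derivedS (subv_trans sAH sHA)) sAH).
apply: (subv_trans perf); apply: derivedS.
exact: (subv_trans perf (derivedS sHA)).
Qed.

End HamiltonianSpace.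

(** * The prime field inside a ring of characteristic [p] *)

Section FpIn.
Variables (R : comNzRingType) (p : nat).
Hypothesis charRp : p \in [pchar R].

Lemma Fp_inD (u v : 'F_p) : Fp_in R (u + v) = Fp_in R u + Fp_in R v.
Proof.
have p_pr := pcharf_prime charRp.
rewrite /Fp_in /= [X in (_ %% X)%N](Fp_cast p_pr) -natrD [in RHS](divn_eq (u + v) p).
by rewrite natrD natrM (pcharf0 charRp) mulr0 add0r.
Qed.

Lemma Fp_inXp (u : 'F_p) : Fp_in R u ^+ p = Fp_in R u.
Proof.
by rewrite /Fp_in -(pFrobenius_autE charRp) pFrobenius_aut_nat.
Qed.

Lemma Fp_in_inj : injective (@Fp_in R p).
Proof.
have p_pr := pcharf_prime charRp.
have ltp (u : 'F_p) : (u < p)%N by rewrite -[X in (_ < X)%N](Fp_cast p_pr).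
have main (u v : 'F_p) : (u <= v)%N -> Fp_in R u = Fp_in R v -> u = v.
  move=> le_uv E; apply: val_inj; apply/eqP; rewrite eqn_leq le_uv /= -subn_eq0.
  have : (p %| v - u)%N by rewrite (dvdn_pcharf charRp) natrB // -/(Fp_in R v) -E subrr.
  move/dvdn_leq; case: (v - u)%N (leq_subr u v) => // k h /(_ isT).
  by rewrite leqNgt (leq_ltn_trans h).
move=> u v E; case/orP: (leq_total u v) => h; first exact: main.
by symmetry; apply: main.
Qed.

End FpIn.

(** * The basis of the space of Hamiltonian derivations *)

Section HamiltonBasisSpan.
Variables (F : fieldType) (p n2 : nat).
Hypotheses (charFp : p \in [pchar F]) (n2_gt0 : (0 < n2)%N).
Notation DP := (divpow F p 1 n2).
Notation VF := (vfield F p 1 n2).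
Notation q := (p ^ n2)%N.

Let p_pr : prime p := pcharf_prime charFp.

Let q_gt1 : (1 < q)%N.
Proof. by rewrite -(exp1n n2) ltn_exp2r ?prime_gt1. Qed.

(** For a fixed degree in [y], the given elements are power sums in [a]; inversion over the [p]
    elements of the prime field isolates the monomials. *)
Lemma ham_space_sub (W : {vspace VF}) :
    (forall j a, (0 < j < q)%N -> ham_e1 F n2 j a \in W) ->
    (forall a, ham_ebar a \in W) ->
  (ham_space F p 1 n2 <= W)%VS.
Proof.
move=> We Wbar.
have cardFp : #|'F_p| = p by rewrite card_Fp.
have Wxy i j : (i < p)%N -> (0 < j < q)%N -> ham (mon i j : DP) \in W.
  move=> lti hj; have jq := hj.
  (* The extra term of [ham_e1] is independent of [a], so it is attached to [i = 0], where the power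
     of [a] is [1] even for [a = 0]. *)
  pose m i : VF := ham ((mon i j : DP) + (i == 0)%N%:R *: (j%:R *: mon p.-1 j)).
  have Wm k : (k < p)%N -> m k \in W.
    rewrite -[in X in X -> _]cardFp; apply: (mem_power_sums (@Fp_in_inj F p charFp)) => a.
    rewrite cardFp; suff -> : \sum_(0 <= i < p) Fp_in F a ^+ i *: m i = ham_e1 F n2 j a.
      exact: We.
    rewrite /ham_e1 /m; under eq_bigr => l _ do rewrite -linearZ scalerDr.
    rewrite -linear_sum big_split addrC; congr (ham (_ + _)).
    rewrite big_ltn ?prime_gt0 //= expr0 !scale1r big_nat big1 ?addr0 //.
    by move=> [|l] // _; rewrite scale0r scaler0.
  (* The index [p - 1] is nonzero, so [m p.-1] carries no extra term and yields the one to be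
     removed from [m 0]. *)
  have Wtop : ham (mon p.-1 j : DP) \in W.
    have := Wm p.-1; rewrite prednK ?prime_gt0 // => /(_ (leqnn _)).
    rewrite /m -subn1 subn_eq0 leqNgt prime_gt1 // scale0r addr0 subn1.
    exact.
  have := Wm i lti; rewrite /m linearD linearZ linearZ /= => h.
  rewrite -[X in X \in W](addrK ((i == 0)%N%:R *: (j%:R *: ham (mon p.-1 j : DP)))).
  by rewrite rpredB ?rpredZ.
have Wx i : (i < p)%N -> ham (mon i 0 : DP) \in W.
  move=> lti.
  (* The sum in [ham_ebar] starts at [1]; index [0] is padded with zero to have [p] terms. *)
  pose m i : VF := if i is 0%N then 0 else ham ((mon i 0 : DP) - i%:R *: mon i q.-1).
  have Wm k : (k < p)%N -> m k \in W.
    rewrite -[in X in X -> _]cardFp; apply: (mem_power_sums (@Fp_in_inj F p charFp)) => a.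
    rewrite cardFp; suff -> : \sum_(0 <= i < p) Fp_in F a ^+ i *: m i = ham_ebar a.
      exact: Wbar.
    rewrite big_ltn ?prime_gt0 // scaler0 add0r /ham_ebar linear_sum !big_nat.
    by apply: eq_bigr => -[|l] // _; rewrite linearZ.
  case: i lti (Wm i lti) => [|i] lti h.
    by rewrite (ham1 n2 charFp) ?rpred0.
  (* The monomial subtracted has [y]-degree [q - 1 > 0] and is covered by [Wxy]. *)
  rewrite -[X in X \in W](subrK (i.+1%:R *: ham (mon i.+1 q.-1 : DP))).
  rewrite rpredD ?rpredZ ?Wxy //; first by rewrite -linearZ -linearB.
  by rewrite -subn1 subn_gt0 q_gt1 subn1 prednK ?(ltnW q_gt1) // leqnn.
apply/subvP => D /ham_spaceP[f ->]; rewrite (dp_expand f) linear_sum.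
apply: rpred_sum => i _; rewrite linear_sum; apply: rpred_sum => j _.
rewrite linearZ rpredZ //=; have lti : (i < p)%N by exact: ltn_ord i.
case: (posnP j) => [->|j_gt0]; first exact: Wx.
by rewrite Wxy // j_gt0 ltn_ord.
Qed.

Lemma size_ham_basis : size (ham_basis F p n2) = (p * q).-1.
Proof.
have p_gt0 := prime_gt0 p_pr.
rewrite /ham_basis size_cat size_allpairs size_iota size_map.
have -> : size [seq a <- enum 'F_p | a != 0] = p.-1.
  rewrite size_filter -[p in RHS](card_Fp p_pr) -(cardC1 (0 : 'F_p)) cardE.
  by rewrite enumT [in RHS]/enum_mem size_filter.
rewrite -cardE card_Fp //; case: q q_gt1 => // k _.
by rewrite mulnS /= mulnC; case: p p_gt0 => //= m _; rewrite addnC.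
Qed.

(** The family spans and has [p (q - 1) + (p - 1) = p q - 1] members, which is the dimension. *)
Lemma ham_space_basis : basis_of (ham_space F p 1 n2) (ham_basis F p n2).
Proof.
rewrite basisEdim size_ham_basis dim_ham_space // andbC expn1 leqnn /=.
apply: ham_space_sub => [j a jq | a].
  rewrite memv_span // mem_cat -(ham_eE _ _ jq); apply/orP; left.
  apply: (allpairs_f (fun j a => ham_e (1 - j%:Z) a)); last by rewrite mem_enum.
  by rewrite mem_iota add1n prednK ?(ltnW q_gt1).
have [->|a0] := eqVneq a 0.
  rewrite /ham_ebar big_nat big1 ?linear0 ?mem0v // => -[|i] // _.
  by rewrite /Fp_in exprS mul0r scale0r.
by rewrite memv_span // mem_cat orbC map_f // mem_filter a0 mem_enum.
Qed.

End HamiltonBasisSpan.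

(** * The isomorphism from the Block algebra *)

Lemma poissonZ (F : fieldType) (p n1 n2 : nat) (c d : F) (f g : divpow F p n1 n2) :
  poisson (c *: f) (d *: g) = (c * d) *: poisson f g.
Proof.
have xZ a (h : divpow F p n1 n2) : ddx (a *: h) = a *: ddx h by exact: linearZ.
have yZ a (h : divpow F p n1 n2) : ddy (a *: h) = a *: ddy h by exact: linearZ.
rewrite /poisson !xZ !yZ !dp_scaleE dp_constM.
move: (dp_const _ _ _ c) (dp_const _ _ _ d) (ddx f) (ddx g) (ddy f) (ddy g) => *.
ring.
Qed.

Section BlockIsomorphism.
Variables (p n2 : nat) (K F : finFieldType) (iota : {rmorphism K -> F}) (eps : F).
Hypotheses (p_pr : prime p) (n2_gt0 : (0 < n2)%N).
Hypotheses (cardK : #|K| = (p ^ n2)%N) (charFp : p \in [pchar F]).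
Hypothesis eps_pow : eps ^+ (p ^ n2 - 1) = -1.
Notation DP := (divpow F p 1 n2).
Notation VF := (vfield F p 1 n2).
Notation q := (p ^ n2)%N.

Let q_gt1 : (1 < q)%N.
Proof. by rewrite -(exp1n n2) ltn_exp2r ?prime_gt1. Qed.

Let charKp : p \in [pchar K].
Proof. exact: card_finPcharP cardK p_pr. Qed.

Let eps_neq0 : eps != 0.
Proof.
apply/eqP => e0; move/eqP: eps_pow.
by rewrite e0 expr0n subn_eq0 leqNgt q_gt1 eq_sym oppr_eq0 oner_eq0.
Qed.

Let epsXq : eps ^+ q = - eps.
Proof. by rewrite -(subnK (ltnW q_gt1)) exprD eps_pow mulN1r. Qed.

Let iotaXq (b : K) : iota b ^+ q = iota b.
Proof. by rewrite -rmorphXn -cardK expf_card. Qed.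

Let ratioXq (b : K) : (iota b / eps) ^+ q = - (iota b / eps).
Proof. by rewrite expr_div_n iotaXq epsXq invrN mulrN. Qed.

Let iota_Fp (u : 'F_p) : iota (Fp_in K u) = Fp_in F u.
Proof. exact: rmorph_nat. Qed.

Definition block_image (a : 'F_p) (b : K) : VF :=
  ham (eps *: dp_exp p 1 n2 (Fp_in F a) (iota b / eps)).

Lemma ham_scale c (f : DP) : ham (c *: f) = c *: ham f.
Proof. exact: linearZ. Qed.

Lemma block_imageE (a : 'F_p) (b : K) :
  block_image a b = eps *: ham (dp_exp p 1 n2 (Fp_in F a) (iota b / eps)).
Proof. exact: ham_scale. Qed.

Lemma block_image_0r (a : 'F_p) : block_image a 0 = eps *: ham_ebar a.
Proof.
rewrite block_imageE rmorph0 mul0r (dp_exp_0 charFp) // linearD /= (ham1 n2 charFp) //.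
by rewrite add0r.
Qed.

Lemma block_image_sub (a : 'F_p) (b : K) :
  block_image a b - block_image a 0
  = eps *: \sum_(1 <= j < q) (iota b / eps) ^+ j *: ham_e1 F n2 j a.
Proof.
rewrite !block_imageE rmorph0 mul0r -scalerBr -(linearB (@ham F p 1 n2)).
rewrite (dp_exp_sub charFp) //.
rewrite linear_sum; congr (_ *: _); apply: eq_bigr => j _; exact: ham_scale.
Qed.

Lemma block_image00 : block_image 0 0 = 0.
Proof.
rewrite block_image_0r /ham_ebar big_nat big1 ?linear0 ?scaler0 // => -[|i] // _.
by rewrite /Fp_in exprS mul0r scale0r.
Qed.

(** Of the two factors [eps] one cancels the denominator in [iota b / eps]; the other is the
    prefactor of the image. *)
Lemma vf_br_block_image (u v : 'F_p) (a b : K) :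
  vf_br (block_image u a) (block_image v b)
  = iota (Fp_in K v * a - Fp_in K u * b) *: block_image (u + v) (a + b).
Proof.
apply: (etrans (ham_poisson charFp _ _)); apply: etrans (ham_scale _ _).
rewrite /block_image; congr ham.
transitivity ((eps * eps) *: poisson (dp_exp p 1 n2 (Fp_in F u) (iota a / eps))
                                     (dp_exp p 1 n2 (Fp_in F v) (iota b / eps))).
  exact: poissonZ.
have FpX (w : 'F_p) : Fp_in F w ^+ (p ^ 1) = Fp_in F w by exact: Fp_inXp.
rewrite (poisson_dp_exp charFp (isT : (0 < 1)%N) n2_gt0 (FpX u) (FpX v)
  (ratioXq a) (ratioXq b)).
rewrite (Fp_inD charFp) (rmorphD iota a b) mulrDl [LHS]scalerA [RHS]scalerA.
congr (_ *: _); rewrite rmorphB !rmorphM /= !iota_Fp.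
by field.
Qed.

Definition block_to_ham (x : block F p K) : VF :=
  \sum_(s : block_index p K) (x : {ffun _ -> _}) s *: block_image (val s).1 (val s).2.

Fact block_to_ham_linear : linear block_to_ham.
Proof.
move=> c x y; rewrite /block_to_ham scaler_sumr -big_split; apply: eq_bigr => s _ /=.
by rewrite scalerA -scalerDl !ffunE.
Qed.

HB.instance Definition _ := GRing.isLinear.Build F (block F p K) VF *:%R
  block_to_ham block_to_ham_linear.

Lemma block_to_ham_gen (a : 'F_p) (b : K) :
  block_to_ham (block_gen a b) = block_image a b.
Proof.
have [[-> ->]|nz] := eqVneq (a, b) 0.
  by rewrite block_gen0 linear0 block_image00.
rewrite /block_to_ham (bigD1 (exist (fun s : 'F_p * K => s != 0) _ nz : block_index p K)) //=.
rewrite ffunE eqxx scale1r big1 ?addr0 // => -[s ns]; rewrite -val_eqE /= => ne.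
by rewrite ffunE /= (negPf ne) scale0r.
Qed.

Lemma block_to_ham_br (x y : block F p K) :
  block_to_ham (block_br iota x y) = vf_br (block_to_ham x) (block_to_ham y).
Proof.
pose brr D : {linear VF -> VF} :=
  HB.pack (vf_br D) (GRing.isLinear.Build F VF VF *:%R _ (vf_br_linearr D)).
pose brl D : {linear VF -> VF} :=
  HB.pack ((@vf_br F p 1 n2)^~ D) (GRing.isLinear.Build F VF VF *:%R _ (vf_br_linearl D)).
have blZ (D E : VF) c : vf_br (c *: E) D = c *: vf_br E D by rewrite -[LHS]/(brl D _) linearZ.
have brZ (D E : VF) c : vf_br D (c *: E) = c *: vf_br D E by rewrite -[LHS]/(brr D _) linearZ.
have bl_sum (D : VF) (I : finType) (f : I -> VF) : vf_br (\sum_i f i) D = \sum_i vf_br (f i) D.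
  by rewrite -[LHS]/(brl D _) linear_sum.
have br_sum (D : VF) (I : finType) (f : I -> VF) : vf_br D (\sum_i f i) = \sum_i vf_br D (f i).
  by rewrite -[LHS]/(brr D _) linear_sum.
have tauZ c z : block_to_ham (c *: z) = c *: block_to_ham z by exact: linearZ.
rewrite /block_br linear_sum [in RHS]/block_to_ham bl_sum.
apply: eq_bigr => s _; rewrite linear_sum br_sum.
apply: eq_bigr => t _; rewrite blZ brZ vf_br_block_image.
case: (val s) (val t) => [u a] [v b] /=.
by rewrite tauZ block_to_ham_gen !scalerA.
Qed.

Definition block_hom : 'Hom(block F p K, VF) := linfun block_to_ham.

Lemma block_hom_gen (a : 'F_p) (b : K) : block_hom (block_gen a b) = block_image a b.
Proof. by rewrite lfunE /= block_to_ham_gen. Qed.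

(** Modulo [q - 1] the residue of [- k] is [q - 1 - k], and its successor is [q - k]. *)
Lemma ham_e_block (k : nat) (a : 'F_p) :
  (0 < k < q)%N -> ham_e k%:Z a = ham_e1 F n2 (q - k) a.
Proof.
case/andP=> k_gt0 ltkq; rewrite /ham_e.
have -> : - k%:Z = -1 * (q.-1)%:Z + (q.-1 - k)%:Z.
  rewrite -subzn ?mulN1r ?addKr //; by rewrite -ltnS prednK // ltnW.
rewrite modzMDl modz_nat absz_nat modn_small; last first.
  by rewrite ltn_subrL k_gt0 -subn1 subn_gt0.
by rewrite -subSn ?prednK ?(ltnW q_gt1) // -ltnS prednK // ltnW.
Qed.

(** For fixed [a] the images are power sums in [b], so inversion over the [q] elements of [K]
    isolates the multiples of [ham_e1 j a]. *)
Lemma limg_block_hom : limg block_hom = ham_space F p 1 n2.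
Proof.
apply/eqP; rewrite eqEsubv; apply/andP; split.
  apply/subvP => _ /memv_imgP[x _ ->]; rewrite lfunE /= memv_suml // => s _.
  by rewrite memvZ // mem_ham.
have Wi a b : block_image a b \in limg block_hom.
  by rewrite -block_hom_gen memv_img ?memvf.
apply: (ham_space_sub charFp) => // [j a jq|a]; last first.
  by rewrite -(scalerK eps_neq0 (ham_ebar a)) memvZ // -block_image_0r.
(* Index [0] holds the image at [b = 0], so that the power sum at each [b] is exactly
   [block_image a b]. *)
pose m j : VF := if j is 0%N then block_image a 0
                 else (eps * eps ^- j) *: ham_e1 F n2 j a.
have : m j \in limg block_hom.
  have iota_inj : injective iota := fmorph_inj iota.
  apply: (mem_power_sums iota_inj) => [b|]; last by rewrite cardK; case/andP: jq.
  rewrite cardK big_ltn ?(ltnW q_gt1) // expr0 scale1r.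
  suff -> : \sum_(1 <= i < q) iota b ^+ i *: m i = block_image a b - block_image a 0.
    by rewrite addrC subrK.
  rewrite block_image_sub scaler_sumr !big_nat; apply: eq_bigr => -[|i] // _.
  by rewrite /m !scalerA expr_div_n mulrCA.
case: j jq => // j _ /(memvZ (eps * eps ^- j.+1)^-1); rewrite /m scalerK //.
by rewrite mulf_neq0 // invr_eq0 expf_neq0.
Qed.

(** Source and image both have dimension [p q - 1]. *)
Lemma lker_block_hom : lker block_hom == 0%VS.
Proof.
have := limg_ker_dim block_hom fullv; rewrite limg_block_hom dim_ham_space // capfv.
have -> : \dim {: block F p K} = (p ^ 1 * q).-1.
  rewrite dimvf; transitivity (#|{: block_index p K}| * 1)%N; first by [].
  rewrite muln1 card_sig -[RHS]/(p * q).-1.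
  have := cardC1 (0 : 'F_p * K); rewrite card_prod card_Fp // cardK => <-.
  by apply: eq_card.
by rewrite -dimv_eq0 => /(canRL (addnK _)); rewrite subnn => ->.
Qed.

(** Each index [(w, g)] is a sum of two indices with nonzero structure constant, so its image is a
    multiple of a bracket. *)
Lemma ham_space_perfect :
  (ham_space F p 1 n2 <= derived (@vf_br F p 1 n2) (ham_space F p 1 n2))%VS.
Proof.
rewrite -{1}limg_block_hom; apply/subvP => _ /memv_imgP[x _ ->].
rewrite lfunE /= memv_suml // => -[[w g] /= nz] _; rewrite memvZ //.
have Ti a b : block_image a b \in ham_space F p 1 n2 by exact: mem_ham.
suff [u [a ne]] : exists u a, Fp_in K (w - u) * a - Fp_in K u * (g - a) != 0 :> K.
  have := vf_br_block_image u (w - u) a (g - a).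
  rewrite ![_ + (_ - _)]addrC !subrK => E.
  have ne' : iota (Fp_in K (w - u) * a - Fp_in K u * (g - a)) != 0.
    by rewrite fmorph_eq0.
  by rewrite -(scalerK ne' (block_image w g)) memvZ // -E mem_derived.
have Fp0 : Fp_in K (0 : 'F_p) = 0 by [].
(* If [w = 0] then [g] is nonzero and the choice [1, 0] gives [- g]; otherwise [0, 1] gives [w]. *)
have [w0|w_neq0] := eqVneq w 0.
  exists 1, 0; rewrite mulr0 subr0 sub0r oppr_eq0 mulf_neq0 //.
    by rewrite -Fp0 (inj_eq (Fp_in_inj charKp)) oner_eq0.
  by move: nz; rewrite w0; apply: contraNneq => ->.
exists 0, 1; rewrite Fp0 subr0 mul0r subr0 mulr1.
by rewrite -Fp0 (inj_eq (Fp_in_inj charKp)).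
Qed.

Lemma eps_exp (b : K) (j : nat) :
  eps * (iota b / eps) ^+ j = eps ^ (1 - j%:Z) * iota b ^+ j.
Proof.
by rewrite expfzDr // expr1z -exprnN expr_div_n mulrCA mulrC.
Qed.

(** With [k = q - j], [b ^ (1 - q) = 1] removes [q] from the exponent of [b], while
    [eps ^+ q = - eps] yields the sign in the first formula for tau. *)
Lemma reindexed_coef (b : K) (j : nat) : b != 0 -> (j <= q)%N ->
  iota b ^ (1 - (q - j)%:Z) * eps ^+ (q - j) = - (eps * (iota b / eps) ^+ j).
Proof.
move=> b0 lejq; have ib0 : iota b != 0 by rewrite fmorph_eq0.
have -> : iota b ^ (1 - (q - j)%:Z) = iota b ^+ j.
  rewrite -subzn // opprB addrCA expfzDr // expfzDr // expr1z -exprnN iotaXq.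
  by rewrite divff ?mulr1.
have -> : eps ^+ (q - j) = - (eps * eps ^- j).
  by rewrite exprB ?unitfE // epsXq mulNr.
by rewrite mulrN expr_div_n mulrCA.
Qed.

End BlockIsomorphism.

(** * Assembly of the basis, the explicit formulas and the isomorphism *)

Theorem theorem8p1 (p n2 : nat) (K F : finFieldType)
    (iota : {rmorphism K -> F}) (eps : F)
    (p_prime : prime p) (n2_gt0 : (0 < n2)%N)
    (cardK : #|K| = (p ^ n2)%N) (cardF : #|F| = ((p ^ n2) ^ 2)%N)
    (eps_pow : eps ^+ (p ^ n2 - 1) = -1) :
  basis_of (hamilton2 F p 1 n2) (ham_basis F p n2) /\
  exists tau : 'Hom(block F p K, vfield F p 1 n2),
    [/\ forall (a : 'F_p) (b : K), b != 0 ->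
          tau (block_gen a b)
          = - \sum_(1 <= k < p ^ n2)
                (iota b ^ (1 - k%:Z) * eps ^+ k) *: ham_e k%:Z a
            + eps *: ham_ebar a,
        forall a : 'F_p, tau (block_gen a 0) = eps *: ham_ebar a,
        forall (a : 'F_p) (b : K), b != 0 ->
          tau (block_gen a b - block_gen a 0)
          = ham (\sum_(1 <= j < p ^ n2)
                   (j%:R * eps ^ (1 - j%:Z) * iota b ^+ j) *: mon p.-1 j
                 + \sum_(0 <= i < p) \sum_(1 <= j < p ^ n2)
                   (eps ^ (1 - j%:Z) * Fp_in F a ^+ i * iota b ^+ j)
                     *: mon i j),
        forall a : 'F_p,
          tau (block_gen a 0)
          = ham (eps *: \sum_(1 <= i < p)
                   Fp_in F a ^+ i *: (mon i 0 - i%:R *: mon i (p ^ n2).-1))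
      & lie_isomorphism_onto (block_br iota) (@vf_br F p 1 n2) tau
          (hamilton2 F p 1 n2)].
Proof.
have charFp : p \in [pchar F].
  by apply: (@card_finPcharP F p (n2 * 2)) => //; rewrite cardF expnM.
rewrite (hamilton2_ham_space charFp) //; last first.
  exact: (ham_space_perfect iota p_prime n2_gt0 cardK charFp eps_pow).
have q_gt1 : (1 < p ^ n2)%N by rewrite -(exp1n n2) ltn_exp2r ?prime_gt1.
have genE := block_hom_gen iota eps n2_gt0 charFp.
have imE0 := block_image_0r iota eps n2_gt0 charFp.
have imB := block_image_sub iota eps n2_gt0 charFp.
split; first exact: ham_space_basis.
exists (block_hom p n2 iota eps); split.
(* The sum over [j] from [block_image_sub] is reversed by [k = q - j]. *)
- move=> a b b0; rewrite genE -[LHS](subrK (block_image n2 iota eps a 0)) imB imE0.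
  congr (_ + _); rewrite scaler_sumr -sumrN [RHS]big_nat_rev /= !big_nat.
  apply: eq_bigr => j /andP[j_gt0 ltjq]; rewrite add1n subSS scalerA -scaleNr.
  rewrite ham_e_block ?subn_gt0 ?ltjq ?ltn_subrL ?j_gt0 ?(ltnW q_gt1) //.
  rewrite subKn ?(ltnW ltjq) //; congr (_ *: _).
  have := reindexed_coef iota p_prime n2_gt0 cardK eps_pow b0 (ltnW ltjq) => ->.
  by rewrite opprK.
- by move=> a; rewrite genE imE0.
- move=> a b b0; rewrite linearB /= !genE imB.
  have -> : \sum_(1 <= j < p ^ n2) (iota b / eps) ^+ j *: ham_e1 F n2 j a
     = ham (\sum_(1 <= j < p ^ n2) (iota b / eps) ^+ j
         *: (j%:R *: mon p.-1 j + \sum_(0 <= i < p) Fp_in F a ^+ i *: mon i j)).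
    by rewrite linear_sum; apply: eq_bigr => j _; symmetry; exact: ham_scale.
  rewrite -ham_scale; congr ham; rewrite exchange_big /= -big_split scaler_sumr.
  apply: eq_bigr => j _; rewrite scalerA (eps_exp iota p_prime n2_gt0 eps_pow) scalerDr.
  rewrite scalerA scaler_sumr; congr (_ *: _ + _).
    by rewrite mulrC mulrA.
  by apply: eq_bigr => i _; rewrite scalerA mulrAC.
- by move=> a; rewrite genE imE0 /ham_ebar -ham_scale.
- split; [exact: lker_block_hom | exact: limg_block_hom |].
  by move=> a b; rewrite !lfunE /= block_to_ham_br.
Qed.
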